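(* Let $J\in\mathbb{C}^{q\times q}$ be a signature matrix, let $F\in\mathbb{C}^{q\times q}\langle\langle z_1,\ldots,z_N\rangle\rangle_{\rm rat}$ be a rational formal power series which is matrix-$J$-unitary on $\mathcal{J}_N$, and let $\alpha=(N;A,B,C,D;\mathbb{C}^\gamma=\bigoplus_{k=1}^N\mathbb{C}^{\gamma_k},\mathbb{C}^q)$ be a minimal GR-realization of $F$. Then $F$ is matrix-$J$-inner in $\mathcal{P}_N$ if and only if the structured Hermitian matrix $H={\rm diag}(H_1,\ldots,H_N)$ associated with $\alpha$ is strictly positive (positive definite).
   Context: Formal power series. $\mathcal{F}_N$ is the free monoid on generators $g_1,\ldots,g_N$ with empty word $\emptyset$. A formal power series (FPS) in non-commuting indeterminates $z_1,\ldots,z_N$ is $f(z)=\sum_{w\in\mathcal{F}_N}f_wz^w$, where $z^w=z_{i_1}\cdots z_{i_n}$ for $w=g_{i_1}\cdots g_{i_n}$; the indeterminates commute with coefficients and products are by convolution over factorizations of words. A scalar FPS is rational if it is obtained from non-commutative polynomials by finitely many sums, products and inversions (of FPSs with non-zero constant term); a matrix FPS is rational if all its entries are. GR-nodes. A GR-node $\alpha=(N;A,B,C,D;\mathbb{C}^r=\bigoplus_{k=1}^N\mathbb{C}^{r_k},\mathbb{C}^q)$ consists of matrices $A\in\mathbb{C}^{r\times r}$, $B\in\mathbb{C}^{r\times q}$, $C\in\mathbb{C}^{q\times r}$, $D\in\mathbb{C}^{q\times q}$, with blocks $A_{ij},B_i,C_j$ along the decomposition of $\mathbb{C}^r$. Its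 transfer function is the rational FPS $T^{\rm nc}_\alpha(z)=D+C(I_r-\Delta(z)A)^{-1}\Delta(z)B$ with $\Delta(z)={\rm diag}(z_1I_{r_1},\ldots,z_NI_{r_N})$, i.e. the coefficient at $\emptyset$ is $D$ and at $w=g_{j_1}\cdots g_{j_n}$ it is $C_{j_1}A_{j_1j_2}\cdots A_{j_{n-1}j_n}B_{j_n}$. $\alpha$ is a GR-realization of $F$ if $T_\alpha^{\rm nc}=F$; it is minimal if each $r_k$ is the smallest possible among all GR-realizations of $F$. For minimal realizations one writes $\gamma_k$ for $r_k$ and $\gamma=\sum_k\gamma_k$. Evaluation. For $Z=(Z_1,\ldots,Z_N)\in(\mathbb{C}^{n\times n})^N$, $F(Z)$ is obtained by substituting $Z_k$ for $z_k$ in a rational expression for $F$; near $Z=0$ it equals $\sum_wF_w\otimes Z^w$, and it is a $\mathbb{C}^{q\times q}\otimes\mathbb{C}^{n\times n}$-valued rational function of the entries of the $Z_k$, defined (holomorphic) on an open dense set containing a neighbourhood of $0$. Matrix-$J$-unitarity and innerness. A signature matrix is $J$ with $J=J^*=J^{-1}$. Let $\mathbb{H}^{n\times n}$ be the set of Hermitian $n\times n$ matrices and $\mathcal{J}_N=\coprod_{n\in\mathbb{N}}(i\mathbb{H}^{n\times n})^N$. $F$ is matrix-$J$-unitary on $\mathcal{J}_N$ if for every $n$, $F(Z)(J\otimes I_n)F(Z)^*=J\otimes I_n$ at all $Z\in(i\mathbb{H}^{n\times n})^N$ where $F(Z)$ is defined. Let $(\Pi^{n\times n})^N=\{Z\in(\mathbb{C}^{n\times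 n})^N: Z_k+Z_k^*>0,\ k=1,\ldots,N\}$, with closure ${\rm clos}(\Pi^{n\times n})^N=\{Z: Z_k+Z_k^*\ge0,\ k=1,\ldots,N\}$, and $\mathcal{P}_N=\coprod_n(\Pi^{n\times n})^N$. A matrix-$J$-unitary on $\mathcal{J}_N$ rational FPS $F$ is matrix-$J$-inner in $\mathcal{P}_N$ if for each $n\in\mathbb{N}$, $F(Z)(J\otimes I_n)F(Z)^*\le J\otimes I_n$ at those points $Z\in{\rm clos}(\Pi^{n\times n})^N$ where $F(Z)$ is defined. Associated structured Hermitian matrix. If $F$ is matrix-$J$-unitary on $\mathcal{J}_N$ and $\alpha$ is a minimal GR-realization of $F$, there is a unique invertible Hermitian matrix $H={\rm diag}(H_1,\ldots,H_N)$, $H_k\in\mathbb{C}^{\gamma_k\times\gamma_k}$, with $A^*H+HA=-C^*JC$ and $B=-H^{-1}C^*JD$; it is called the structured Hermitian matrix associated with $\alpha$. *)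

(* Defs.v *)
From HB Require Import structures.
From mathcomp Require Import all_boot all_order all_algebra.
From mathcomp Require Import sesquilinear spectral.
From mathcomp Require Import complex mxtens reals.

Set Implicit Arguments.
Unset Strict Implicit.
Unset Printing Implicit Defensive.

Import Order.TTheory GRing.Theory Num.Theory.
Local Open Scope ring_scope.
Local Open Scope sesquilinear_scope.

Section Matrices.
Context {C : numClosedFieldType}.

Definition psdmx n (A : 'M[C]_n) : Prop :=
  A \is hermsymmx /\ forall v : 'rV[C]_n, 0 <= (v *m A *m v ^t*) 0 0.

Definition posdefmx n (A : 'M[C]_n) : Prop :=
  A \is hermsymmx /\ forall v : 'rV[C]_n, v != 0 -> 0 < (v *m A *m v ^t*) 0 0.

Definition loewner_le n (A B : 'M[C]_n) : Prop := psdmx (B - A).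

Definition signature_mx q (J : 'M[C]_q) : Prop :=
  [/\ J \in unitmx, J = J ^t* & J = invmx J].

(* The set (i H^{n x n})^N. *)
Definition imag_herm N n (Z : 'I_N -> 'M[C]_n) : Prop :=
  forall k, exists2 X : 'M[C]_n, X \is hermsymmx & Z k = 'i *: X.

(* The set clos (Pi^{n x n})^N. *)
Definition clos_halfplane N n (Z : 'I_N -> 'M[C]_n) : Prop :=
  forall k, psdmx (Z k + Z k ^t*).

End Matrices.

(* A formal power series is its family of coefficients; the word
   g_{i_1} ... g_{i_n} is the sequence [:: i_1; ...; i_n]. *)
Definition word (N : nat) := seq 'I_N.
Definition fps (C : Type) (N : nat) := word N -> C.
Definition mxfps (C : Type) (N q : nat) := word N -> 'M[C]_q.

Definition mxfps_entry (C : Type) N q (F : mxfps C N q) (i j : 'I_q) :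
  fps C N := fun w => F w i j.

Section Fps.
Context {C : fieldType} {N : nat}.
Implicit Types f g : fps C N.

Definition fps_const (c : C) : fps C N := fun w => if w is [::] then c else 0.
Definition fps_var (k : 'I_N) : fps C N := fun w => (w == [:: k])%:R.
Definition fps_add f g : fps C N := fun w => f w + g w.
Definition fps_mul f g : fps C N :=
  fun w => \sum_(i < (size w).+1) f (take i w) * g (drop i w).

End Fps.

Inductive nc_expr (C : Type) (N : nat) : Type :=
| NcConst of C
| NcVar of 'I_N
| NcAdd of nc_expr C N & nc_expr C N
| NcMul of nc_expr C N & nc_expr C N
| NcInv of nc_expr C N.

(* [nc_represents e f]: all inversions occurring in [e] are inversions of
   power series with non-zero constant term, and [e] then yields [f]. *)
Fixpoint nc_represents (C : fieldType) N (e : nc_expr C N) (f : fps C N) :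
    Prop :=
  match e with
  | NcConst c => f =1 fps_const c
  | NcVar k => f =1 fps_var k
  | NcAdd e1 e2 => exists f1 f2,
      [/\ nc_represents e1 f1, nc_represents e2 f2 & f =1 fps_add f1 f2]
  | NcMul e1 e2 => exists f1 f2,
      [/\ nc_represents e1 f1, nc_represents e2 f2 & f =1 fps_mul f1 f2]
  | NcInv e1 => exists f1,
      [/\ nc_represents e1 f1, f1 [::] != 0,
          fps_mul f f1 =1 fps_const 1 & fps_mul f1 f =1 fps_const 1]
  end.

Definition rational_fps (C : fieldType) N (f : fps C N) : Prop :=
  exists e, nc_represents e f.

Definition rational_mxfps (C : fieldType) N q (F : mxfps C N q) : Prop :=
  forall i j, rational_fps (mxfps_entry F i j).

(* Substitution of matrices for the indeterminates: [nc_eval Z e] is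
   meaningful only when [nc_defined Z e], since [invmx] is total. *)
Fixpoint nc_eval (C : fieldType) N n (Z : 'I_N -> 'M[C]_n) (e : nc_expr C N) :
    'M[C]_n :=
  match e with
  | NcConst c => c%:M
  | NcVar k => Z k
  | NcAdd e1 e2 => nc_eval Z e1 + nc_eval Z e2
  | NcMul e1 e2 => nc_eval Z e1 *m nc_eval Z e2
  | NcInv e1 => invmx (nc_eval Z e1)
  end.

Fixpoint nc_defined (C : fieldType) N n (Z : 'I_N -> 'M[C]_n)
    (e : nc_expr C N) : bool :=
  match e with
  | NcConst _ | NcVar _ => true
  | NcAdd e1 e2 | NcMul e1 e2 => nc_defined Z e1 && nc_defined Z e2
  | NcInv e1 => nc_defined Z e1 && (nc_eval Z e1 \in unitmx)
  end.

(* [mxfps_value F Z M]: F(Z) is defined and equal to M. Here F(Z) is the sum of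
   E_ij (x) F_ij(Z) over the matrix units E_ij, where each F_ij(Z) is obtained
   by substitution in some rational expression for the entry F_ij that can be
   evaluated at Z. *)
Definition mxfps_value (C : fieldType) N q (F : mxfps C N q) n
    (Z : 'I_N -> 'M[C]_n) (M : 'M[C]_(q * n)) : Prop :=
  exists e : 'I_q -> 'I_q -> nc_expr C N,
    [/\ forall i j, nc_represents (e i j) (mxfps_entry F i j),
        forall i j, nc_defined Z (e i j) &
        M = \sum_(i < q) \sum_(j < q) (delta_mx i j *t nc_eval Z (e i j))].

Section Innerness.
Context {C : numClosedFieldType} {N q : nat}.
Implicit Types (J : 'M[C]_q) (F : mxfps C N q).

(* The size n = 0 is allowed below, where both conditions hold trivially. *)
Definition matrix_J_unitary J F : Prop :=
  forall n (Z : 'I_N -> 'M[C]_n) (M : 'M[C]_(q * n)),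
    imag_herm Z -> mxfps_value F Z M ->
    M *m (J *t 1%:M) *m M ^t* = J *t 1%:M.

Definition matrix_J_inner J F : Prop :=
  matrix_J_unitary J F /\
  forall n (Z : 'I_N -> 'M[C]_n) (M : 'M[C]_(q * n)),
    clos_halfplane Z -> mxfps_value F Z M ->
    loewner_le (M *m (J *t 1%:M) *m M ^t*) (J *t 1%:M).

End Innerness.

Record gr_node (C : Type) (N q : nat) := GRNode {
  gr_dim : 'I_N -> nat;
  gr_A : 'M[C]_(\sum_k gr_dim k);
  gr_B : 'M[C]_(\sum_k gr_dim k, q);
  gr_C : 'M[C]_(q, \sum_k gr_dim k);
  gr_D : 'M[C]_q
}.

Section GRNodes.
Context {C : fieldType} {N q : nat}.
Implicit Types (alpha beta : gr_node C N q) (F : mxfps C N q).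

(* [gr_path alpha j_1 [:: j_2; ...; j_n]] is
   A_{j_1 j_2} ... A_{j_{n-1} j_n} B_{j_n}. *)
Fixpoint gr_path alpha (j : 'I_N) (w : word N) : 'M[C]_(gr_dim alpha j, q) :=
  if w is k :: w' then submxblock (gr_A alpha) j k *m gr_path alpha k w'
  else submxcol (gr_B alpha) j.

Definition gr_transfer alpha : mxfps C N q := fun w =>
  if w is j :: w' then submxrow (gr_C alpha) j *m gr_path alpha j w'
  else gr_D alpha.

Definition gr_realization F alpha : Prop := gr_transfer alpha =1 F.

Definition gr_minimal_realization F alpha : Prop :=
  gr_realization F alpha /\
  forall beta, gr_realization F beta ->
    forall k, (gr_dim alpha k <= gr_dim beta k)%N.

End GRNodes.

(* [H] is the matrix diag (H_1, ..., H_N) associated with a node. *)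
Definition associated_structured_hermitian (C : numClosedFieldType) N q
    (J : 'M[C]_q) (alpha : gr_node C N q)
    (H : 'M[C]_(\sum_k gr_dim alpha k)) : Prop :=
  [/\ exists Hb : forall k, 'M[C]_(gr_dim alpha k), H = \mxdiag_k Hb k,
      H \is hermsymmx,
      H \in unitmx,
      (gr_A alpha) ^t* *m H + H *m gr_A alpha
        = - ((gr_C alpha) ^t* *m J *m gr_C alpha) &
      gr_B alpha = - (invmx H *m (gr_C alpha) ^t* *m J *m gr_D alpha)].

(* Main.v *)
Require Import Defs.
From HB Require Import structures.
From mathcomp Require Import all_boot all_order all_algebra.
From mathcomp Require Import sesquilinear spectral.
From mathcomp Require Import complex mxtens reals ring.

Set Implicit Arguments.
Unset Strict Implicit.
Unset Printing Implicit Defensive.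

Import Order.TTheory GRing.Theory Num.Theory.
Local Open Scope ring_scope.
Local Open Scope sesquilinear_scope.

(** A vector of [C^q (x) C^n] is a matrix [V : 'M_(n, q)]; with [Zt k = (Z k)^T]
    and [P k] the projection onto the k-th block of the state space, the value
    of [F] at [Z] sends [V] to [V' = V D + S B], where [S = \sum_k Zt k Y P k]
    and the state [Y] solves [Y = V C + S A]. The equations satisfied by [H] give
      tr (V J V^* ) - tr (V' J V'^* )
        = \sum_k tr ((Zt k + (Zt k)^* ) (Y P k) H^-1 (Y P k)^* ).
    If [H > 0] the right-hand side is nonnegative on the closed half-plane. This
    is first obtained at [t Z] for all but finitely many [t] in ]0, 1[, because
    [I - t Delta(Z) A] may be singular at [t = 1] although [F(Z)] is defined, and
    then in the limit.
    Conversely, take all [Zt j] skew-Hermitian except that [Zt k] has real part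
    [e^* e], with [e] a row: innerness says that the k-th block of [H^-1] is
    nonnegative at the vector [e Y] (k-th block). By minimality the node is
    observable, which makes [V |-> e Y] onto for some arbitrary complex
    matrices [W j]. Moving from [W] along an affine path that meets the
    boundary of the half-plane when its parameter is imaginary, a determinant
    does not vanish identically, hence [V |-> e Y] is onto at some admissible
    point, and the block is nonnegative. *)

(** * Evaluation of rational expressions along the ray [t Z] *)

Section Congruence.
Context {C : fieldType}.

(** Congruence modulo ['X ^ m] stands in for equality of power series in t, so that only polynomial
    matrices occur. *)
Definition eqmodX (m : nat) a b (P Q : 'M[{poly C}]_(a, b)) :=
  exists R, P = Q + 'X^m *: R.

Lemma eqmodX_refl m a b (P : 'M[{poly C}]_(a, b)) : eqmodX m P P.
Proof. by exists 0; rewrite scaler0 addr0. Qed.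

Lemma eqmodX_sym m a b (P Q : 'M[{poly C}]_(a, b)) :
  eqmodX m P Q -> eqmodX m Q P.
Proof. by case=> R ->; exists (- R); rewrite scalerN addrK. Qed.

Lemma eqmodX_trans m a b (Q P S : 'M[{poly C}]_(a, b)) :
  eqmodX m P Q -> eqmodX m Q S -> eqmodX m P S.
Proof. by case=> R -> [R' ->]; exists (R' + R); rewrite scalerDr addrA. Qed.

Lemma eqmodX0 a b (P Q : 'M[{poly C}]_(a, b)) : eqmodX 0 P Q.
Proof. by exists (P - Q); rewrite expr0 scale1r subrKC. Qed.

Lemma eqmodXD m a b (P P' Q Q' : 'M[{poly C}]_(a, b)) :
  eqmodX m P Q -> eqmodX m P' Q' -> eqmodX m (P + P') (Q + Q').
Proof. by case=> R -> [R' ->]; exists (R + R'); rewrite scalerDr addrACA. Qed.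

Lemma eqmodX_sum m a b (I : finType) (P Q : I -> 'M[{poly C}]_(a, b)) :
  (forall i, eqmodX m (P i) (Q i)) -> eqmodX m (\sum_i P i) (\sum_i Q i).
Proof.
move=> PQ; elim/big_ind2: _ => [|*|*]; [exact: eqmodX_refl| exact: eqmodXD|].
exact: PQ.
Qed.

Lemma eqmodXZ m a b (p : {poly C}) (P Q : 'M[{poly C}]_(a, b)) :
  eqmodX m P Q -> eqmodX m (p *: P) (p *: Q).
Proof. by case=> R ->; exists (p *: R); rewrite scalerDr !scalerA mulrC. Qed.

Lemma eqmodXMl m a b c (S : 'M_(c, a)) (P Q : 'M[{poly C}]_(a, b)) :
  eqmodX m P Q -> eqmodX m (S *m P) (S *m Q).
Proof. by case=> R ->; exists (S *m R); rewrite mulmxDr scalemxAr. Qed.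

Lemma eqmodXMr m a b c (S : 'M_(b, c)) (P Q : 'M[{poly C}]_(a, b)) :
  eqmodX m P Q -> eqmodX m (P *m S) (Q *m S).
Proof. by case=> R ->; exists (R *m S); rewrite mulmxDl scalemxAl. Qed.

Lemma eqmodX_tr m a b (P Q : 'M[{poly C}]_(a, b)) :
  eqmodX m P Q -> eqmodX m P^T Q^T.
Proof. by case=> R ->; exists R^T; rewrite linearD linearZ. Qed.

Lemma eqmodXS m a b (P Q : 'M[{poly C}]_(a, b)) :
  eqmodX m P Q -> eqmodX m.+1 ('X *: P) ('X *: Q).
Proof. by case=> R ->; exists R; rewrite scalerDr scalerA -exprS. Qed.

Lemma eqmodXW m a b (P Q : 'M[{poly C}]_(a, b)) :
  eqmodX m.+1 P Q -> eqmodX m P Q.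
Proof. by case=> R ->; exists ('X *: R); rewrite scalerA -exprSr. Qed.

(** A nonzero polynomial of size s is not divisible by ['X ^ s]; the congruence is therefore used at
    m equal to the size of each entry of the difference. *)
Lemma eqmodX_eq a b (P Q : 'M[{poly C}]_(a, b)) :
  (forall m, eqmodX m P Q) -> P = Q.
Proof.
move=> PQ; apply/matrixP => i j; apply/eqP; rewrite -subr_eq0.
have [R /matrixP/(_ i j)] := PQ (size (P i j - Q i j)); rewrite !mxE => E'.
have E : P i j - Q i j = 'X^(size (P i j - Q i j)) * R i j.
  by rewrite {1}E' addrAC subrr add0r.
apply: contraTeq isT => nz.
have := congr1 (size : {poly C} -> nat) E.
have [R0|Rn0] := eqVneq (R i j) 0.
  by move: nz; rewrite E R0 mulr0 eqxx.
rewrite [in RHS]mulrC size_Mmonic ?monicXn // size_polyXn => /eqP.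
by rewrite addnS /= -[X in X == _]add0n eqn_add2r eq_sym size_poly_eq0 (negPf Rn0).
Qed.

Lemma eqmodX_ev0 m a b (P Q : 'M[{poly C}]_(a, b)) : eqmodX m.+1 P Q ->
  map_mx (horner_eval 0) P = map_mx (horner_eval 0) Q.
Proof.
case=> R ->; apply/matrixP => i j.
by rewrite !mxE !horner_evalE hornerD hornerM hornerXn expr0n mul0r addr0.
Qed.

End Congruence.

Section Evaluation.
Context {C : fieldType} {N n : nat}.
Implicit Types (f g : fps C N) (Z : 'I_N -> 'M[C]_n).

(* The truncation modulo [t ^ m] of [\sum_w f_w t ^ |w| Z ^ w]. *)
Fixpoint nc_trunc Z m f : 'M[{poly C}]_n :=
  if m is m'.+1 then
    (f [::])%:P%:M + 'X *: \sum_k map_mx polyC (Z k) *m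
                                 nc_trunc Z m' (fun w => f (k :: w))
  else 0.

Lemma nc_trunc_ext Z m f g : f =1 g -> nc_trunc Z m f = nc_trunc Z m g.
Proof.
elim: m f g => //= m IH f g fg; rewrite fg; congr (_ + _ *: _).
by apply: eq_bigr => k _; rewrite (IH _ (fun w => g (k :: w))).
Qed.

Lemma nc_truncD Z m f g :
  nc_trunc Z m (fps_add f g) = nc_trunc Z m f + nc_trunc Z m g.
Proof.
elim: m f g => /= [|m IH] f g; first by rewrite addr0.
rewrite /fps_add polyCD raddfD addrACA; congr (_ + _).
rewrite -scalerDr -big_split; congr (_ *: _); apply: eq_bigr => k _ /=.
by rewrite -mulmxDr -IH.
Qed.

Lemma nc_truncZ Z m c f :
  nc_trunc Z m (fun w => c * f w) = c%:P *: nc_trunc Z m f.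
Proof.
elim: m f => /= [|m IH] f; first by rewrite scaler0.
rewrite polyCM scalerDr scale_scalar_mx; congr (_ + _).
rewrite [RHS]scalerA mulrC -scalerA; congr (_ *: _).
by rewrite scaler_sumr; apply: eq_bigr => k _ /=; rewrite IH scalemxAr.
Qed.

Lemma nc_trunc0 Z m : nc_trunc Z m (fun=> 0) = 0.
Proof.
elim: m => //= m IH; rewrite IH raddf0 add0r big1 ?scaler0 // => k _.
by rewrite mulmx0.
Qed.

Lemma nc_trunc_const Z m c :
  nc_trunc Z m.+1 (fps_const c) = c%:P%:M.
Proof.
rewrite /= big1 ?scaler0 ?addr0 // => k _.
by rewrite nc_trunc0 mulmx0.
Qed.

(** Only a congruence: for m = 1 the truncation is 0, since the word [[:: k]] has length 1. *)
Lemma nc_trunc_var Z m k :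
  eqmodX m (nc_trunc Z m (fps_var k)) ('X *: map_mx polyC (Z k)).
Proof.
case: m => [|m]; first exact: eqmodX0.
rewrite /= /fps_var /= raddf0 add0r; apply: eqmodXS.
case: m => [|m]; first exact: eqmodX0.
have Ek j : nc_trunc Z m.+1 (fun w => (j :: w == [:: k])%:R) = (j == k)%:R%:M.
  have [->|jk] := eqVneq j k.
    rewrite (nc_trunc_ext _ _ (g := fps_const 1)) ?nc_trunc_const //.
    by case=> [|a w]; rewrite eqseq_cons ?eqxx ?andbF.
  rewrite (nc_trunc_ext _ _ (g := fun=> 0)) ?nc_trunc0 ?raddf0 // => w.
  by rewrite eqseq_cons (negPf jk).
rewrite (bigD1 k) // Ek eqxx mulmx1 big1 => [|j jk].
  by rewrite /= addr0; exact: eqmodX_refl.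
by rewrite Ek (negPf jk) raddf0 mulmx0.
Qed.

Lemma nc_truncW Z m f : eqmodX m (nc_trunc Z m.+1 f) (nc_trunc Z m f).
Proof.
elim: m f => [|m IH] f; first exact: eqmodX0.
rewrite [nc_trunc Z m.+2 f]/= [nc_trunc Z m.+1 f]/=.
apply: eqmodXD; first exact: eqmodX_refl.
by apply: eqmodXS; apply: eqmodX_sum => k; apply/eqmodXMl/IH.
Qed.

Lemma fps_mul_cons f g k w :
  fps_mul f g (k :: w) =
    f [::] * g (k :: w) + fps_mul (fun u => f (k :: u)) g w.
Proof. by rewrite /fps_mul /= big_ord_recl /=; congr (_ + _). Qed.

(** Induction on m, splitting off the first letter of a word with [fps_mul_cons]. *)
Lemma nc_truncM Z m f g :
  eqmodX m (nc_trunc Z m (fps_mul f g)) (nc_trunc Z m f *m nc_trunc Z m g).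
Proof.
elim: m f g => [|m IH] f g; first exact: eqmodX0.
rewrite [nc_trunc Z m.+1 f]/= mulmxDl mul_scalar_mx -scalemxAl.
(* The factor ['X] in front makes the truncation of g at order m as good as the one at order m +
   1. *)
have tail : eqmodX m.+1
    ('X *: ((\sum_k map_mx polyC (Z k) *m nc_trunc Z m (fun w => f (k :: w)))
             *m nc_trunc Z m g))
    ('X *: ((\sum_k map_mx polyC (Z k) *m nc_trunc Z m (fun w => f (k :: w)))
             *m nc_trunc Z m.+1 g)).
  by apply/eqmodXS/eqmodXMl/eqmodX_sym/nc_truncW.
apply: (eqmodX_trans _ (eqmodXD (eqmodX_refl _ _) tail)) => /=.
rewrite /fps_mul big_ord1 take0 drop0 polyCM scalerDr scale_scalar_mx -addrA.
apply: eqmodXD; first exact: eqmodX_refl.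
rewrite scalerA [_ * 'X]mulrC -scalerA -scalerDr; apply: eqmodXS.
rewrite scaler_sumr mulmx_suml -big_split; apply: eqmodX_sum => k.
rewrite /= scalemxAr -mulmxA -mulmxDr -nc_truncZ; apply: eqmodXMl.
rewrite (nc_trunc_ext _ _ (fps_mul_cons f g k)).
rewrite (nc_truncD _ _ (fun w => f [::] * g (k :: w))).
by apply: eqmodXD; [exact: eqmodX_refl | exact: IH].
Qed.

(** On the ray t Z the value of an expression is a quotient P(t) / p(t), where p vanishes exactly
    where the expression is undefined. The last clause ties P / p to the power series, hence to data
    independent of the chosen expression; p(0) is nonzero because only series with nonzero constant
    term are inverted. *)
Lemma nc_eval_rational (e : nc_expr C N) f Z : nc_represents e f ->
  exists (p : {poly C}) (P : 'M[{poly C}]_n),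
  [/\ p.[0] != 0,
      forall t, nc_defined (fun k => t *: Z k) e = (p.[t] != 0),
      forall t, p.[t] != 0 -> nc_eval (fun k => t *: Z k) e
                              = p.[t]^-1 *: map_mx (horner_eval t) P &
      forall m, eqmodX m P (p *: nc_trunc Z m f)].
Proof.
elim: e f => [c|k|e1 IH1 e2 IH2|e1 IH1 e2 IH2|e1 IH1] f /=.
- move=> fE; exists 1, c%:P%:M; split=> [|t|t _|m]; rewrite ?hornerC ?oner_eq0 //.
    rewrite invr1 scale1r map_scalar_mx.
    by congr (_%:M); rewrite /= horner_evalE hornerC.
  rewrite scale1r (nc_trunc_ext _ _ fE).
  by case: m => [|m]; [exact: eqmodX0 | rewrite nc_trunc_const; exact: eqmodX_refl].
- move=> fE; exists 1, ('X *: map_mx polyC (Z k)).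
  split=> [|t|t _|m]; rewrite ?hornerC ?oner_eq0 //.
    rewrite invr1 scale1r; apply/matrixP => i j.
    by rewrite !mxE /= horner_evalE hornerM hornerX hornerC.
  by rewrite scale1r (nc_trunc_ext _ _ fE); apply/eqmodX_sym/nc_trunc_var.
- move=> [f1 [f2 [/IH1 [p1 [P1 [p10 d1 v1 c1]]] /IH2 [p2 [P2 [p20 d2 v2 c2]]] fE]]].
  exists (p1 * p2), (p2 *: P1 + p1 *: P2).
  split=> [|t|t|m]; rewrite ?hornerM ?d1 ?d2 ?mulf_eq0 ?negb_or ?p10 ?p20 //.
    case/andP=> p1t p2t; rewrite v1 // v2 //; apply/matrixP => i j.
    rewrite !mxE /= !horner_evalE hornerD !hornerM.
    by field; rewrite p1t p2t.
  rewrite (nc_trunc_ext _ _ fE) nc_truncD scalerDr.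
  apply: eqmodXD; last by rewrite -scalerA; apply: eqmodXZ.
  by rewrite mulrC -scalerA; apply: eqmodXZ.
- move=> [f1 [f2 [/IH1 [p1 [P1 [p10 d1 v1 c1]]] /IH2 [p2 [P2 [p20 d2 v2 c2]]] fE]]].
  exists (p1 * p2), (P1 *m P2).
  split=> [|t|t|m]; rewrite ?hornerM ?d1 ?d2 ?mulf_eq0 ?negb_or ?p10 ?p20 //.
    case/andP=> p1t p2t; rewrite v1 // v2 // map_mxM.
    by rewrite -scalemxAl -scalemxAr scalerA invfM.
  rewrite (nc_trunc_ext _ _ fE).
  apply: (eqmodX_trans (eqmodXMl _ (c2 m))).
  apply: (eqmodX_trans (eqmodXMr _ (c1 m))).
  rewrite -scalemxAl -scalemxAr scalerA; apply: eqmodXZ.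
  exact/eqmodX_sym/nc_truncM.
move=> [f1 [/IH1 [p1 [P1 [p10 d1 v1 c1]]] f10 ff1 _]].
have detE t : (\det P1).[t] = \det (map_mx (horner_eval t) P1).
  by rewrite det_map_mx.
(* The inverse of P1 / p1 is p1 adj P1 / det P1. Numerator and denominator get an extra factor p1,
   so that the denominator also vanishes where the inner expression is undefined. *)
exists (p1 * \det P1), (p1 ^+ 2 *: \adj P1); split=> [|t|t|m].
- rewrite hornerM mulf_neq0 // detE (eqmodX_ev0 (c1 1)) /= big1 => [|k _].
    rewrite scaler0 addr0 scale_scalar_mx map_scalar_mx det_scalar expf_neq0 //.
    by rewrite /= horner_evalE hornerM hornerC mulf_neq0.
  by rewrite mulmx0.
- rewrite d1 hornerM mulf_eq0 negb_or; case: (p1.[t] =P 0) => //= /eqP p1t.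
  rewrite v1 // unitmxE detZ unitfE mulf_eq0 expf_eq0 invr_eq0 (negPf p1t).
  by rewrite andbF detE.
- rewrite hornerM mulf_eq0 negb_or => /andP[p1t dt]; rewrite v1 //.
  have u : map_mx (horner_eval t) P1 \in unitmx by rewrite unitmxE unitfE -detE.
  rewrite invmxZ ?unitmxZ ?unitfE ?invr_eq0 // invrK /invmx u map_mxZ map_mx_adj /=.
  rewrite -detE !scalerA; congr (_ *: _).
  rewrite horner_evalE horner_exp; field; by rewrite p1t dt.
case: m => [|m]; first exact: eqmodX0.
set S := nc_trunc Z m.+1 f.
have SP : eqmodX m.+1 (S *m P1) (p1 *: 1%:M).
  apply: (eqmodX_trans (eqmodXMl _ (c1 _))); rewrite -scalemxAr; apply: eqmodXZ.
  apply: (eqmodX_trans (eqmodX_sym (nc_truncM _ _ _ _))).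
  by rewrite (nc_trunc_ext _ _ ff1) nc_trunc_const; exact: eqmodX_refl.
have := eqmodXMr (\adj P1) SP.
rewrite -mulmxA mul_mx_adj mul_mx_scalar -scalemxAl mul1mx => /eqmodX_sym E.
by rewrite expr2 -!scalerA; apply: eqmodXZ.
Qed.

End Evaluation.

(** * State equation of a node *)

Section StateOperator.
Context {R : comNzRingType} {N n g : nat}.
Variables (Z : 'I_N -> 'M[R]_n) (P : 'I_N -> 'M[R]_g).

Definition delta_op (Y : 'M[R]_(n, g)) : 'M[R]_(n, g) :=
  \sum_k Z k *m Y *m P k.

Fact delta_op_is_linear : linear delta_op.
Proof.
move=> a X Y; rewrite /delta_op scaler_sumr -big_split; apply: eq_bigr => k _ /=.
by rewrite mulmxDr mulmxDl -scalemxAr -scalemxAl.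
Qed.
HB.instance Definition _ :=
  GRing.isLinear.Build R _ _ _ delta_op delta_op_is_linear.

Variable A : 'M[R]_g.

(** Vectorizing the state turns I - Delta(Z) A into the square matrix [1%:M - state_mx Z P A], to
    which determinants and adjugates apply. *)
Definition state_op (y : 'rV[R]_(n * g)) : 'rV[R]_(n * g) :=
  mxvec (delta_op (vec_mx y) *m A).

Fact state_op_is_linear : linear state_op.
Proof.
by move=> a x y; rewrite /state_op !linearP /= mulmxDl -scalemxAl !linearP.
Qed.
HB.instance Definition _ :=
  GRing.isLinear.Build R _ _ _ state_op state_op_is_linear.

Definition state_mx : 'M[R]_(n * g) := lin1_mx state_op.

Lemma mul_mxvec_state_mx Y : mxvec Y *m state_mx = mxvec (delta_op Y *m A).
Proof. by rewrite mul_rV_lin1 /= /state_op mxvecK. Qed.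

End StateOperator.

Lemma map_delta_op (R S : comNzRingType) (f : {rmorphism R -> S}) N n g
    (Z : 'I_N -> 'M[R]_n) (P : 'I_N -> 'M[R]_g) (Y : 'M[R]_(n, g)) :
  map_mx f (delta_op Z P Y) =
    delta_op (fun k => map_mx f (Z k)) (fun k => map_mx f (P k)) (map_mx f Y).
Proof.
by rewrite /delta_op map_mx_sum; apply: eq_bigr => k _; rewrite !map_mxM.
Qed.

Lemma map_state_mx (R S : comNzRingType) (f : {rmorphism R -> S}) N n g
    (Z : 'I_N -> 'M[R]_n) (P : 'I_N -> 'M[R]_g) (A : 'M[R]_g) :
  map_mx f (state_mx Z P A) =
    state_mx (fun k => map_mx f (Z k)) (fun k => map_mx f (P k)) (map_mx f A).
Proof.
apply: map_lin1_mx => v.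
by rewrite /state_op map_mxvec map_mxM map_delta_op map_vec_mx.
Qed.

Lemma delta_opZ (R : comNzRingType) N n g
    (Z : 'I_N -> 'M[R]_n) (P : 'I_N -> 'M[R]_g) t (Y : 'M[R]_(n, g)) :
  delta_op (fun k => t *: Z k) P Y = t *: delta_op Z P Y.
Proof.
by rewrite /delta_op scaler_sumr; apply: eq_bigr => k _; rewrite -!scalemxAl.
Qed.

Lemma state_mxZ (R : comNzRingType) N n g
    (Z : 'I_N -> 'M[R]_n) (P : 'I_N -> 'M[R]_g) A t :
  state_mx (fun k => t *: Z k) P A = t *: state_mx Z P A.
Proof.
apply/matrixP => i j; rewrite !mxE.
by rewrite /state_op delta_opZ -scalemxAl linearZ mxE.
Qed.

Lemma state_mxD (R : comNzRingType) N n g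
    (Z Z' : 'I_N -> 'M[R]_n) (P : 'I_N -> 'M[R]_g) A :
  state_mx (fun k => Z k + Z' k) P A = state_mx Z P A + state_mx Z' P A.
Proof.
apply/row_matrixP => i; rewrite !rowE mulmxDr -[delta_mx _ _]vec_mxK.
rewrite !mul_mxvec_state_mx -raddfD -mulmxDl /delta_op -big_split /=.
by congr (mxvec (_ *m _)); apply: eq_bigr => k _; rewrite -!mulmxDl.
Qed.

(** Paths in the whole state space: with projections in place of blocks, the type does not depend on
    the first letter as that of [gr_path] does. *)
Fixpoint path_mx (C : fieldType) N g q (P : 'I_N -> 'M[C]_g) (A : 'M[C]_g)
    (B : 'M[C]_(g, q)) (w : word N) : 'M[C]_(g, q) :=
  if w is k :: w' then A *m P k *m path_mx P A B w' else B.

Section Nodes.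
Context {C : fieldType} {N q : nat}.
Implicit Type alpha : gr_node C N q.

Section Blocks.
Variable r : 'I_N -> nat.
Notation g := (\sum_k r k)%N.

Definition block_proj k : 'M[C]_g := submxrow 1%:M k *m submxcol 1%:M k.

Lemma mulmx_block_proj a b (X : 'M_(a, g)) (Y : 'M_(g, b)) k :
  X *m block_proj k *m Y = submxrow X k *m submxcol Y k.
Proof.
rewrite /block_proj mulmxA mul_submxrow mulmx1 -mulmxA submxcol_mul.
by rewrite mul1mx.
Qed.

Lemma sum_block_proj : \sum_k block_proj k = 1%:M.
Proof. by rewrite -mul_mxrow_mxcol submxrowK submxcolK mulmx1. Qed.

End Blocks.

Lemma gr_pathE alpha j w :
  gr_path alpha j w = 
    submxcol (path_mx (@block_proj _) (gr_A alpha) (gr_B alpha) w) j.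
Proof.
elim: w j => //= k w IH j.
by rewrite mulmx_block_proj IH -submxcol_mul submxblockEh.
Qed.

Lemma gr_transfer_cons alpha k w : gr_transfer alpha (k :: w) =
  
  gr_C alpha *m block_proj _ k *m
    path_mx (@block_proj _) (gr_A alpha) (gr_B alpha) w.
Proof. by rewrite mulmx_block_proj /= gr_pathE. Qed.

End Nodes.

Section Truncation.
Context {C : fieldType} {N q n : nat}.
Variable Z : 'I_N -> 'M[C]_n.
Local Notation "M ^P" := (map_mx polyC M) (at level 2).
Let ZT k := ((Z k)^T)^P.

Definition mx_trunc m (V : 'M[{poly C}]_(n, q)) (F : mxfps C N q) :=
  \sum_i \sum_j (nc_trunc Z m (mxfps_entry F i j))^T *m V *m delta_mx i j.

Lemma mx_trunc_ext m V F G : F =1 G -> mx_trunc m V F = mx_trunc m V G.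
Proof.
move=> FG; apply: eq_bigr => i _; apply: eq_bigr => j _.
by congr (_^T *m _ *m _); apply: nc_trunc_ext => w; rewrite /mxfps_entry FG.
Qed.

Lemma mx_truncS m V F : mx_trunc m.+1 V F =
  V *m (F [::])^P
  + 'X *: \sum_k mx_trunc m (ZT k *m V) (fun w => F (k :: w)).
Proof.
pose T k i j := nc_trunc Z m (fun w => mxfps_entry F i j (k :: w)).
transitivity (\sum_i \sum_j ((F [::] i j)%:P *: (V *m delta_mx i j) +
    'X *: \sum_k (T k i j)^T *m (ZT k *m V) *m delta_mx i j)).
  apply: eq_bigr => i _; apply: eq_bigr => j _ /=.
  rewrite linearD linearZ linear_sum /= tr_scalar_mx !mulmxDl mul_scalar_mx.
  rewrite -!scalemxAl !mulmx_suml; congr (_ + _ *: _).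
  by apply: eq_bigr => k _; rewrite trmx_mul map_trmx !mulmxA.
under eq_bigr do rewrite big_split /= -scaler_sumr; rewrite big_split /=.
congr (_ + _).
  rewrite [in RHS](matrix_sum_delta (F [::])^P) mulmx_sumr.
  apply: eq_bigr => i _; rewrite mulmx_sumr; apply: eq_bigr => j _.
  by rewrite mxE scalemxAr.
rewrite -scaler_sumr; congr (_ *: _).
rewrite [RHS]exchange_big; apply: eq_bigr => i _.
by rewrite [RHS]exchange_big.
Qed.

Section State.
Variables (g : nat) (P : 'I_N -> 'M[C]_g) (A : 'M[C]_g) (B : 'M[C]_(g, q)).

(** The first m terms of the Neumann series of the resolvent of t Delta(Z) A applied to u, followed
    by B. *)
Fixpoint state_trunc m (u : 'M[{poly C}]_(n, g)) : 'M[{poly C}]_(n, q) :=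
  if m is m'.+1 then
    u *m B^P + 'X *: state_trunc m' (delta_op ZT (fun k => (P k)^P) (u *m A^P))
  else 0.

Lemma state_truncD m u v :
  state_trunc m (u + v) = state_trunc m u + state_trunc m v.
Proof.
elim: m u v => [|m IH] u v /=; first by rewrite addr0.
by rewrite !mulmxDl linearD /= IH scalerDr addrACA.
Qed.

Lemma state_trunc_sum m (I : finType) (u : I -> 'M_(n, g)) :
  state_trunc m (\sum_i u i) = \sum_i state_trunc m (u i).
Proof.
apply: (big_morph _ (state_truncD m)).
by apply: (addrI (state_trunc m 0)); rewrite -state_truncD !addr0.
Qed.

(** L is general because reading a letter k replaces L by L A P k and V by Zt k V; summed over k,
    this is one step of [state_trunc] on the product V L. *)
Lemma mx_trunc_path m V (L : 'M[C]_(q, g)) :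
  mx_trunc m V (fun w => L *m path_mx P A B w) = state_trunc m (V *m L^P).
Proof.
elim: m V L => [|m IH] V L.
  rewrite /mx_trunc !big1 // => i _; rewrite big1 // => j _.
  by rewrite trmx0 !mul0mx.
rewrite mx_truncS /= map_mxM mulmxA; congr (_ + _ *: _).
rewrite /delta_op state_trunc_sum; apply: eq_bigr => k _.
transitivity (mx_trunc m (ZT k *m V) (fun w => (L *m A *m P k) *m path_mx P A B w)).
  by apply: mx_trunc_ext => w; rewrite -!mulmxA.
by rewrite IH !map_mxM !mulmxA.
Qed.

(** Iterating the fixed-point equation m times leaves a remainder divisible by ['X ^ m]. The factor
    d is a common denominator that keeps x polynomial. *)
Lemma state_trunc_fix m (d : {poly C}) u x :
  x = d *: u + 'X *: delta_op ZT (fun k => (P k)^P) (x *m A^P) ->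
  eqmodX m (x *m B^P) (d *: state_trunc m u).
Proof.
elim: m u x => [|m IH] u x xE; first exact: eqmodX0.
rewrite xE mulmxDl /= scalerDr -scalemxAl; apply: eqmodXD.
  exact: eqmodX_refl.
rewrite -scalemxAl scalerA mulrC -scalerA; apply/eqmodXS/IH.
rewrite {1}xE mulmxDl linearD /= -!scalemxAl.
by rewrite !linearZ.
Qed.

End State.
End Truncation.

Section Values.
Context {C : fieldType} {N q n : nat}.
Implicit Types (Z : 'I_N -> 'M[C]_n) (V : 'M[C]_(n, q)).
Local Notation "M ^P" := (map_mx polyC M) (at level 2).

(** The action of F(Z) on a row vector of the tensor product, reshaped as an n by q matrix: the
    tensor of E_ij with T sends V to T^T V E_ij. *)
Definition nc_mxval (e : 'I_q -> 'I_q -> nc_expr C N) Z V : 'M[C]_(n, q) :=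
  \sum_i \sum_j (nc_eval Z (e i j))^T *m V *m delta_mx i j.

Lemma nc_mxval_rational (e : 'I_q -> 'I_q -> nc_expr C N) (F : mxfps C N q) Z :
  (forall i j, nc_represents (e i j) (mxfps_entry F i j)) ->
  exists (p : {poly C}) (Q : 'M[C]_(n, q) -> 'M[{poly C}]_(n, q)),
  [/\ p.[0] != 0,
      forall t, (forall i j, nc_defined (fun k => t *: Z k) (e i j))
                <-> p.[t] != 0,
      forall t V, p.[t] != 0 -> nc_mxval e (fun k => t *: Z k) V
                              = p.[t]^-1 *: map_mx (horner_eval t) (Q V) &
      forall m V, eqmodX m (Q V) (p *: mx_trunc Z m V^P F)].
Proof.
move=> eF; pose I := ('I_q * 'I_q)%type.
have /fin_all_exists [p /fin_all_exists [Q PQ]] :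
    forall x : I, exists p Q, _ := fun x : I => nc_eval_rational Z (eF x.1 x.2).
pose co x := \prod_(y | y != x) p y; pose pp := \prod_x p x.
have ppE x : pp = p x * co x by rewrite /pp (bigD1 x).
exists pp, (fun V => \sum_i \sum_j (co (i, j) *: Q (i, j))^T *m V^P *m delta_mx i j).
have pp0 t : (pp.[t] != 0) = [forall x, (p x).[t] != 0].
  rewrite horner_prod; apply/prodf_neq0/forallP => [H x|H x _]; exact: H.
split=> [|t|t V|m V].
- by rewrite pp0; apply/forallP => x; case: (PQ x).
- rewrite pp0; split=> [H|/forallP H i j].
    by apply/forallP => x; case: (PQ x) => _ <- _ _; exact: H.
  by case: (PQ (i, j)) => _ -> _ _; exact: H.
- move=> ppt; rewrite /nc_mxval map_mx_sum scaler_sumr; apply: eq_bigr => i _.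
  rewrite map_mx_sum scaler_sumr; apply: eq_bigr => j _.
  have pt : (p (i, j)).[t] != 0 by move: ppt; rewrite pp0 => /forallP/(_ (i, j)).
  have ct : (co (i, j)).[t] != 0.
    by move: ppt; rewrite (ppE (i, j)) hornerM mulf_eq0 negb_or => /andP[].
  case: (PQ (i, j)) => _ _ -> // _; rewrite !map_mxM -map_trmx map_mxZ /=.
  rewrite !linearZ /= -!scalemxAl scalerA horner_evalE (ppE (i, j)) hornerM.
  rewrite invfM mulfVK // map_delta_mx; congr (_ *: (_ *m _ *m _)).
  by apply/matrixP => a b; rewrite !mxE /= horner_evalE hornerC.
rewrite /mx_trunc scaler_sumr; apply: eqmodX_sum => i.
rewrite scaler_sumr; apply: eqmodX_sum => j.
rewrite !scalemxAl -linearZ; do 2!apply: eqmodXMr; apply: eqmodX_tr.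
by rewrite (ppE (i, j)) mulrC -scalerA; apply: eqmodXZ; case: (PQ (i, j)).
Qed.

End Values.

Section NodeValues.
Context {C : fieldType} {N q n : nat}.
Variables (alpha : gr_node C N q) (Z : 'I_N -> 'M[C]_n).
Local Notation "M ^P" := (map_mx polyC M) (at level 2).
Local Notation P := (@block_proj C N (gr_dim alpha)).
Local Notation g := (\sum_k gr_dim alpha k)%N.
Let ZT k := (Z k)^T.

Definition node_op Y := delta_op ZT P Y.

Definition node_mx : 'M[C]_(n * g) := state_mx ZT P (gr_A alpha).

(** Rational expressions and state equation give two quotients of polynomials in t, with
    denominators p and d, that have the same power series at 0. Cross-multiplied, they agree as
    polynomials, so the node computes the value wherever p and d are nonzero, even far from 0. *)
Lemma node_value e (F : mxfps C N q) :
  (forall i j, nc_represents (e i j) (mxfps_entry F i j)) ->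
  gr_realization F alpha ->
  exists (p d : {poly C}) (Q : 'M[C]_(n, q) -> 'M[{poly C}]_(n, q)),
  [/\ p.[0] != 0 /\ d.[0] != 0,
      forall t, (forall i j, nc_defined (fun k => t *: Z k) (e i j))
                <-> p.[t] != 0,
      forall t, d.[t] = \det (1%:M - t *: node_mx),
      forall t V, p.[t] != 0 -> nc_mxval e (fun k => t *: Z k) V
                              = p.[t]^-1 *: map_mx (horner_eval t) (Q V) &
      forall t V, p.[t] != 0 -> d.[t] != 0 -> exists Y,
        Y = V *m gr_C alpha + t *: node_op Y *m gr_A alpha /\
        nc_mxval e (fun k => t *: Z k) V
          = V *m gr_D alpha + t *: node_op Y *m gr_B alpha].
Proof.
move=> eF FE; have [p [Q [p0 pdef pQ Qcong]]] := nc_mxval_rational Z eF.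
pose K := 1%:M - 'X *: node_mx^P; pose d := \det K.
have Kt t : map_mx (horner_eval t) K = 1%:M - t *: node_mx.
  apply/matrixP => i j; rewrite !mxE /= horner_evalE hornerD hornerN hornerM.
  by rewrite hornerX !hornerC -polyC_natr hornerC.
have dt t : d.[t] = \det (1%:M - t *: node_mx) by rewrite -Kt det_map_mx.
exists p, d, Q; split=> //.
  by split=> //; rewrite dt scale0r subr0 det1 oner_eq0.
move=> t V pt dt0.
pose opP := delta_op (fun k => (ZT k)^P) (fun k => (P k)^P).
(* Cramer's rule: this is d times the state, and its entries are polynomials in t. *)
pose Y := vec_mx (mxvec (V *m gr_C alpha)^P *m \adj K).
have YE : Y = d *: (V *m gr_C alpha)^P + 'X *: (opP Y *m (gr_A alpha)^P).
  apply: (can_inj mxvecK); rewrite linearD !linearZ /= -/opP.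
  have -> : mxvec (opP Y *m (gr_A alpha)^P) = mxvec Y *m node_mx^P.
    by rewrite /node_mx map_state_mx mul_mxvec_state_mx.
  have : mxvec Y *m K = d *: mxvec (V *m gr_C alpha)^P.
    by rewrite vec_mxK -mulmxA mul_adj_mx mul_mx_scalar.
  by rewrite mulmxBr mulmx1 -scalemxAr => <-; rewrite subrK.
have QE : d *: Q V =
    p *: (d *: (V *m gr_D alpha)^P + 'X *: (opP Y *m (gr_B alpha)^P)).
  (* Order m + 1 is used so that [mx_truncS] can split off the empty word, leaving order m for the
     state part. *)
  apply: eqmodX_eq => m; apply: eqmodXW.
  apply: (eqmodX_trans (eqmodXZ _ (Qcong m.+1 V))).
  rewrite scalerA mulrC -scalerA; apply/eqmodXZ/eqmodX_sym.
  rewrite mx_truncS scalerDr -FE /= -map_mxM; apply: eqmodXD.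
    exact: eqmodX_refl.
  rewrite scalerA mulrC -scalerA; apply: eqmodXS.
  have -> : \sum_k mx_trunc Z m (((Z k)^T)^P *m V^P) (fun w => F (k :: w)) =
      state_trunc Z P (gr_A alpha) (gr_B alpha) m (opP (V *m gr_C alpha)^P).
    rewrite /opP /delta_op state_trunc_sum; apply: eq_bigr => k _.
    rewrite (@mx_trunc_ext _ _ _ _ _ _ _ _ ( fun w => gr_C alpha *m P k *m
       path_mx P (gr_A alpha) (gr_B alpha) w)).
      by rewrite mx_trunc_path !map_mxM !mulmxA.
    by move=> w; rewrite -FE gr_transfer_cons.
  apply: state_trunc_fix; rewrite {1}YE /opP linearD; congr (_ + _).
    by rewrite linearZ.
  by rewrite linearZ.
have ev_polyC a b (M : 'M[C]_(a, b)) : map_mx (horner_eval t) M^P = M.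
  by apply/matrixP => i j; rewrite !mxE /= horner_evalE hornerC.
have evZ a b (c : {poly C}) (M : 'M[{poly C}]_(a, b)) :
    map_mx (horner_eval t) (c *: M) = c.[t] *: map_mx (horner_eval t) M.
  by rewrite map_mxZ /= horner_evalE.
have opE : map_mx (horner_eval t) (opP Y) = node_op (map_mx (horner_eval t) Y).
  rewrite map_delta_op /node_op /delta_op; apply: eq_bigr => k _.
  by rewrite !ev_polyC.
exists (d.[t]^-1 *: map_mx (horner_eval t) Y); split.
  have := congr1 (map_mx (horner_eval t)) YE.
  rewrite map_mxD !evZ !map_mxM !ev_polyC opE hornerX => {1}->.
  rewrite scalerDr !scalerA mulVf // scale1r /node_op linearZ /= -!scalemxAl.
  by rewrite !scalerA mulrC.
have := congr1 (map_mx (horner_eval t)) QE.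
rewrite !evZ map_mxD !evZ !map_mxM !ev_polyC opE hornerX pQ //.
move/(congr1 (fun M => (p.[t]^-1 * d.[t]^-1) *: M)).
rewrite !scalerA mulfVK // => ->; rewrite scalerDr !scalerA /node_op linearZ /=.
rewrite -!scalemxAl !scalerA; congr (_ + _ *: _); last by field; rewrite pt dt0.
by rewrite -[RHS]scale1r; congr (_ *: _); field; rewrite pt dt0.
Qed.

End NodeValues.

(** * Energy balance *)

Section BlockProjections.
Context {C : numClosedFieldType} {N : nat} {r : 'I_N -> nat}.
Notation g := (\sum_k r k)%N.
Local Notation P := (@block_proj C N r).

Lemma block_proj_mxdiag_offdiag (Hb : forall k, 'M[C]_(r k)) i j : i != j ->
  P i *m (\mxdiag_k Hb k) *m P j = 0.
Proof.
move=> ij; rewrite /block_proj !mulmxA -[_ *m submxcol _ _ *m _]mulmxA.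
rewrite submxcol_mul mul1mx -[_ *m submxcol _ _ *m _]mulmxA mul_submxrow mulmx1.
by rewrite -submxblockEv mxblockK (negPf ij) mulmx0 mul0mx.
Qed.

(** Both sides equal the block diagonal matrix compressed by [P k] on the left and on the right. *)
Lemma block_proj_comm (Hb : forall k, 'M[C]_(r k)) k :
  P k *m (\mxdiag_j Hb j) = (\mxdiag_j Hb j) *m P k.
Proof.
transitivity (P k *m (\mxdiag_j Hb j) *m P k).
  rewrite -[LHS]mulmx1 -sum_block_proj mulmx_sumr; apply: big_only1 => // j jk _.
  by rewrite block_proj_mxdiag_offdiag // eq_sym.
rewrite -[RHS]mul1mx -sum_block_proj mulmx_suml -mulmxA; apply/esym.
by apply: big_only1 => // j jk _; rewrite mulmxA block_proj_mxdiag_offdiag.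
Qed.

Lemma block_proj_id k : P k *m P k = P k.
Proof.
rewrite -[RHS]mul1mx -sum_block_proj mulmx_suml; apply/esym.
apply: big_only1 => // j jk _.
have := block_proj_mxdiag_offdiag (fun i => 1%:M) jk.
by rewrite mxdiagZ mulmx1.
Qed.

Lemma block_proj_adj k : (P k)^t* = P k.
Proof.
rewrite trmx_mul tr_submxcol tr_submxrow trmx1 map_mxM.
by congr (_ *m _); apply/matrixP => i j; rewrite !mxE rmorph_nat.
Qed.

End BlockProjections.

Section Adjoint.
Context {C : numClosedFieldType}.

Lemma adjmxM a b c (A : 'M[C]_(a, b)) (B : 'M[C]_(b, c)) :
  (A *m B)^t* = B^t* *m A^t*.
Proof. by rewrite trmx_mul map_mxM. Qed.

Lemma adjmxD a b (A B : 'M[C]_(a, b)) : (A + B)^t* = A^t* + B^t*.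
Proof. by rewrite linearD map_mxD. Qed.

Lemma adjmxN a b (A : 'M[C]_(a, b)) : (- A)^t* = - A^t*.
Proof. by rewrite linearN map_mxN. Qed.

Lemma adjmxB a b (A B : 'M[C]_(a, b)) : (A - B)^t* = A^t* - B^t*.
Proof. by rewrite adjmxD adjmxN. Qed.

Lemma adjmxZ a b c (A : 'M[C]_(a, b)) : (c *: A)^t* = c^* *: A^t*.
Proof. by rewrite linearZ map_mxZ. Qed.

Lemma adj_invmx n (A : 'M[C]_n) : A^t* = A -> (invmx A)^t* = invmx A.
Proof. by move=> AE; rewrite trmx_inv map_invmx AE. Qed.

Lemma hermsymmxP n (A : 'M[C]_n) : reflect (A^t* = A) (A \is hermsymmx).
Proof.
apply: (iffP (is_hermitianmxP _ _ _)) => /= [{2}->|AE]; first by rewrite scale1r.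
by rewrite scale1r AE.
Qed.

Lemma adjmx_tr a b (A : 'M[C]_(a, b)) : (A^T)^t* = (A^t*)^T.
Proof. by apply/matrixP => i j; rewrite !mxE. Qed.

Lemma psdmx_tr n (A : 'M[C]_n) : psdmx A -> psdmx A^T.
Proof.
move=> [/hermsymmxP hA A0]; split; first by apply/hermsymmxP; rewrite adjmx_tr hA.
move=> v; pose w := map_mx Num.conj v.
suff -> : v *m A^T *m v^t* = (w *m A *m w^t*)^T by rewrite mxE; exact: A0.
rewrite !trmx_mul mulmxA.
by congr (_ *m _ *m _); apply/matrixP => i j; rewrite !mxE ?conjCK.
Qed.

(** In an orthonormal eigenbasis of S the trace is the sum of the eigenvalues weighted by the values
    of the form of K at the eigenvectors. *)
Lemma mxtrace_psd_mul_ge0 n (S K : 'M[C]_n) : psdmx S ->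
  (forall x : 'rV_n, 0 <= (x *m K *m x^t*) 0 0) -> 0 <= \tr (S *m K).
Proof.
move=> [hS S0] K0; have /orthomx_spectralP SE := hermitian_normalmx hS.
move: (spectral_unitarymx S) SE; set U := spectralmx S; set d := spectral_diag S.
move=> Uu SE; have /unitarymxP UU := Uu.
have -> : \tr (S *m K) = \sum_i d 0 i * (U *m K *m U^t*) i i.
  rewrite {1}SE (invmx_unitary Uu) -!mulmxA mxtrace_mulC -!mulmxA.
  by rewrite mul_diag_mx; apply: eq_bigr => i _; rewrite !mxE.
apply: sumr_ge0 => i _.
have rowE (M : 'M[C]_n) : (U *m M *m U^t*) i i = (row i U *m M *m (row i U)^t*) 0 0.
  rewrite -row_mul !mxE; apply: eq_bigr => j _.
  by rewrite !mxE.
apply: mulr_ge0; last by rewrite rowE; exact: K0.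
have -> : d 0 i = (U *m S *m U^t*) i i.
  by rewrite SE (invmx_unitary Uu) !mulmxA UU mul1mx -mulmxA UU mulmx1 mxE eqxx.
by rewrite rowE; exact: S0.
Qed.

Lemma posdef_invmx_ge0 n (H : 'M[C]_n) : H \in unitmx -> posdefmx H ->
  forall x : 'rV_n, 0 <= (x *m invmx H *m x^t*) 0 0.
Proof.
move=> Hu [/hermsymmxP hH H0] x.
have -> : x *m invmx H *m x^t* = (x *m invmx H) *m H *m (x *m invmx H)^t*.
  by rewrite adjmxM (adj_invmx hH) mulmxKV ?mulmxA.
have [->|/H0/ltW//] := eqVneq (x *m invmx H) 0.
by rewrite !mul0mx mxE.
Qed.

End Adjoint.

Section RowVectors.
Context {C : numClosedFieldType} {q n : nat}.
Implicit Types V U : 'M[C]_(n, q).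

(** The index (i, a) reads V at (a, i); with this order the tensor product of A and B acts by V ->
    B^T V A. *)
Definition row_of V : 'rV[C]_(q * n) :=
  \row_x V (mxtens_unindex x).2 (mxtens_unindex x).1.

Lemma row_of_index V i a : row_of V 0 (mxtens_index (i, a)) = V a i.
Proof. by rewrite mxE mxtens_indexK. Qed.

Lemma row_of_surj (v : 'rV[C]_(q * n)) : exists V, v = row_of V.
Proof.
exists (\matrix_(a, i) v 0 (mxtens_index (i, a))); apply/rowP => x.
by case: (mxtens_indexP x) => i a; rewrite row_of_index mxE.
Qed.

Fact row_of_is_linear : linear row_of.
Proof. by move=> a X Y; apply/rowP => x; rewrite !mxE. Qed.
HB.instance Definition _ :=
  GRing.isLinear.Build C _ _ _ row_of row_of_is_linear.

Lemma sum_mxtens (f : 'I_(q * n) -> C) :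
  \sum_x f x = \sum_i \sum_a f (mxtens_index (i, a)).
Proof.
rewrite pair_bigA (reindex (@mxtens_index q n)) /=.
  by apply: eq_bigr => -[].
by exists (@mxtens_unindex q n) => x _; rewrite ?mxtens_indexK ?mxtens_unindexK.
Qed.

Lemma row_of_tens V (A : 'M[C]_q) (B : 'M[C]_n) :
  row_of V *m (A *t B) = row_of (B^T *m V *m A).
Proof.
apply/rowP => x; case: (mxtens_indexP x) => j b.
rewrite row_of_index !mxE sum_mxtens; apply: eq_bigr => i _.
rewrite !mxE mulr_suml; apply: eq_bigr => a _.
by rewrite row_of_index tensmxE !mxE mulrA mulrAC [V a i * _]mulrC.
Qed.

Lemma row_of_dot V U : (row_of V *m (row_of U)^t*) 0 0 = \tr (V *m U^t*).
Proof.
rewrite mxE sum_mxtens exchange_big; apply: eq_bigr => a _.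
by rewrite !mxE; apply: eq_bigr => i _; rewrite row_of_index !mxE mxtens_indexK.
Qed.

Lemma row_of_value N (Z : 'I_N -> 'M[C]_n) (e : 'I_q -> 'I_q -> nc_expr C N) V :
  row_of V *m (\sum_i \sum_j (delta_mx i j *t nc_eval Z (e i j)))
  = row_of (nc_mxval e Z V).
Proof.
rewrite mulmx_sumr linear_sum; apply: eq_bigr => i _.
rewrite mulmx_sumr linear_sum; apply: eq_bigr => j _ /=.
by rewrite row_of_tens.
Qed.

Lemma row_of_form (J : 'M[C]_q) (M : 'M[C]_(q * n)) V V' U U' :
  row_of V *m M = row_of V' -> row_of U *m M = row_of U' ->
  (row_of V *m (M *m (J *t 1%:M) *m M^t*) *m (row_of U)^t*) 0 0
  = \tr (V' *m J *m U'^t*).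
Proof.
move=> VM UM; rewrite !mulmxA VM -mulmxA -adjmxM UM row_of_tens trmx1 mul1mx.
exact: row_of_dot.
Qed.

End RowVectors.

(** * Generic values of a parameter and limits of polynomials *)

Section GenericPoints.
Context {C : numClosedFieldType}.

(** A nonzero p has fewer than [size p] roots, so one of the first [size p] terms of the sequence is
    not a root. *)
Lemma generic_point (p : {poly C}) (s : nat -> C) :
  p != 0 -> injective s -> exists k, p.[s k] != 0.
Proof.
move=> p0 s_inj.
have : ~~ all (root p) [seq s k | k <- iota 0 (size p)].
  apply/negP => /(max_poly_roots p0); rewrite map_inj_uniq ?iota_uniq //.
  by rewrite size_map size_iota ltnn => /(_ isT).
by case/allPn => _ /mapP[k _ ->] sk; exists k.
Qed.

Lemma poly_bounded (p : {poly C}) :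
  exists2 K, 0 <= K & forall t, `|t| <= 1 -> `|p.[t]| <= K.
Proof.
exists (\sum_(i < size p) `|p`_i|); first by apply: sumr_ge0 => i _.
move=> t t1; rewrite horner_coef; apply: le_trans (ler_norm_sum _ _ _) _.
by apply: ler_sum => i _; rewrite normrM normrX ler_piMr // exprn_ile1.
Qed.

(** Continuity of p at 1, made explicit by the factor X - 1 of p - p(1) and a bound for the cofactor
    on the unit disc. *)
Lemma poly_ge0_limit (p r : {poly C}) : r != 0 ->
  (forall t, 0 < t -> t < 1 -> r.[t] != 0 -> 0 <= p.[t]) -> 0 <= p.[1].
Proof.
move=> r0 p_ge0.
have /factor_theorem [Q pE] : root (p - p.[1]%:P) 1.
  by rewrite rootE hornerD hornerN hornerC subrr.
have [K K0 QK] := poly_bounded Q.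
have approx e : 0 < e -> exists2 y, 0 <= y & `|p.[1] - y| <= e.
  (* This choice gives both d <= 1 and K d <= e. *)
  move=> e0; pose d := e / (e + K).
  have eK : 0 < e + K by rewrite ltr_wpDr.
  have d0 : 0 < d by rewrite divr_gt0.
  have d1 : d <= 1 by rewrite ler_pdivrMr // mul1r lerDl.
  (* The denominators start at 2 because d = 1 when K = 0, and the sample points have to be
     positive. *)
  have [|k rk] := generic_point r0 (s := fun k => 1 - d / k.+2%:R).
    move=> i j /addrI/oppr_inj/(mulfI (lt0r_neq0 d0))/invr_inj/eqP.
    by rewrite eqr_nat => /eqP [].
  have k0 : 0 < k.+2%:R :> C by rewrite ltr0n.
  have dk0 : 0 < d / k.+2%:R by rewrite divr_gt0.
  have dk1 : d / k.+2%:R < 1.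
    by rewrite ltr_pdivrMr // mul1r (le_lt_trans d1) // ltr1n.
  have dkd : d / k.+2%:R <= d by rewrite ler_pdivrMr // ler_peMr ?(ltW d0) ?ler1n.
  exists p.[1 - d / k.+2%:R].
    by apply: p_ge0 => //; rewrite ?subr_gt0 // ltrBlDr ltrDl.
  set t := 1 - _.
  have pt : p.[t] - p.[1] = Q.[t] * (t - 1).
    have := congr1 (fun s => s.[t]) pE.
    by rewrite hornerD hornerN hornerC hornerM hornerXsubC.
  rewrite distrC pt normrM /t addrAC subrr add0r normrN (gtr0_norm dk0).
  apply: le_trans (_ : K * d <= e).
    apply: ler_pM => //; first exact: ltW.
    have t0 : 0 <= t by rewrite subr_ge0 ltW.
    by apply: QK; rewrite (ger0_norm t0) lerBlDr lerDl ltW.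
  by rewrite /d mulrA ler_pdivrMr // mulrC ler_wpM2l ?ltW // ltrDr.
move: (p.[1]) approx => c approx.
(* Being nonnegative means being equal to one's norm. If x, the distance from c to |c|, were
   positive, a nonnegative y within x / 3 of c would give x <= 2 x / 3. *)
suff cE : `|c| - c == 0 by move: cE; rewrite subr_eq0 => /eqP <-.
have [//|nz] := eqVneq (`|c| - c) 0.
set x := `| `|c| - c|; have x0 : 0 < x by rewrite normr_gt0.
have [|y y0 yc] := approx (x / 3%:R); first by rewrite divr_gt0.
have xy : x <= x / 3%:R + x / 3%:R.
  apply: le_trans (ler_distD y _ _) _; rewrite [`|y - c|]distrC lerD //.
  by rewrite -{1}(ger0_norm y0) (le_trans (ler_dist_dist _ _)).
have E : x / 3%:R + x / 3%:R = x * (2%:R / 3%:R) by field.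
move: xy; rewrite E.
by rewrite ler_pMr // ler_pdivlMr // mul1r ler_nat.
Qed.
End GenericPoints.

Lemma nc_eval_ext (C : fieldType) N n (Z Z' : 'I_N -> 'M[C]_n) (e : nc_expr C N) :
  Z =1 Z' -> nc_eval Z e = nc_eval Z' e /\ nc_defined Z e = nc_defined Z' e.
Proof.
move=> ZZ; elim: e => //= [e1 [E1 D1] e2 [E2 D2]|e1 [E1 D1] e2 [E2 D2]|e1 [E1 D1]].
- by rewrite E1 E2 D1 D2.
- by rewrite E1 E2 D1 D2.
- by rewrite E1 D1.
Qed.

Lemma nc_mxval_ext (C : fieldType) N q n (Z Z' : 'I_N -> 'M[C]_n)
    (e : 'I_q -> 'I_q -> nc_expr C N) V :
  Z =1 Z' -> nc_mxval e Z V = nc_mxval e Z' V.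
Proof.
move=> ZZ; apply: eq_bigr => i _; apply: eq_bigr => j _.
by have [-> _] := nc_eval_ext (e i j) ZZ.
Qed.

(** The formula for B makes D a right factor of V', and D J D^* = J eliminates it. The Lyapunov
    equation rewrites the term quadratic in S, which cancels against the terms coming from V K = Y -
    S A. *)
Lemma energy_balance (C : numClosedFieldType) n q g (J D : 'M[C]_q)
    (A H : 'M[C]_g) (B : 'M[C]_(g, q)) (K : 'M[C]_(q, g))
    (V V' : 'M[C]_(n, q)) (Y S : 'M[C]_(n, g)) :
  signature_mx J -> H^t* = H -> H \in unitmx ->
  A^t* *m H + H *m A = - (K^t* *m J *m K) ->
  B = - (invmx H *m K^t* *m J *m D) ->
  D *m J *m D^t* = J ->
  Y = V *m K + S *m A -> V' = V *m D + S *m B ->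
  V *m J *m V^t* - V' *m J *m V'^t* = Y *m invmx H *m S^t* + S *m invmx H *m Y^t*.
Proof.
move=> [Ju JJ Jinv] hH Hu AH BE DJD YE V'E.
have JJ1 : J *m J = 1%:M by rewrite {2}Jinv mulmxV.
have hG : (invmx H)^t* = invmx H by apply: adj_invmx.
have GA : invmx H *m K^t* *m J *m K *m invmx H
    = - (invmx H *m A^t* + A *m invmx H).
  have := congr1 (fun M => invmx H *m M *m invmx H) AH.
  rewrite mulmxDr mulmxDl !mulmxA mulmxK // mulVmx // mul1mx => ->.
  by rewrite mulmxN mulNmx opprK !mulmxA.
move: (invmx H) hG GA BE => G hG GA BE.
(* V' = V D + S B with B = - G K^* J D, so V' = T D. *)
pose T := V - S *m G *m K^t* *m J.
have {}V'E : V' = T *m D by rewrite V'E BE mulmxBl mulmxN !mulmxA.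
have -> : V' *m J *m V'^t* = T *m J *m T^t*.
  by rewrite V'E adjmxM -{2}DJD !mulmxA.
have VK : V *m K = Y - S *m A by rewrite YE addrK.
have KV : K^t* *m V^t* = Y^t* - A^t* *m S^t* by rewrite -adjmxM VK adjmxB adjmxM.
have E1 : T *m J = V *m J - S *m G *m K^t*.
  by rewrite mulmxBl -[_ *m J *m J]mulmxA JJ1 mulmx1.
have E2 : T^t* = V^t* - J *m K *m G *m S^t*.
  by rewrite adjmxB !adjmxM -JJ trmxCK hG !mulmxA.
rewrite E1 E2 mulmxBl !mulmxBr !mulmxA -[V *m J *m J]mulmxA JJ1 mulmx1 VK.
rewrite -[S *m G *m K^t* *m V^t*]mulmxA KV.
have -> : S *m G *m K^t* *m J *m K *m G *m S^t*
    = - (S *m (G *m A^t* + A *m G) *m S^t*).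
  by rewrite -mulNmx -mulmxN -GA !mulmxA.
rewrite !(mulmxBl, mulmxBr, mulmxDl, mulmxDr, mulNmx) !mulmxA.
move: (V *m J *m V^t*) (Y *m G *m S^t*) (S *m G *m Y^t*) (S *m A *m G *m S^t*)
  (S *m G *m A^t* *m S^t*) => a b c d f.
by apply/matrixP => i j; rewrite !mxE; ring.
Qed.

(** The inverse of H commutes with each [P k], so every trace splits along the blocks, and the two
    terms of block k add up to the real part of [Z k]. *)
Lemma node_op_balance (C : numClosedFieldType) N n (r : 'I_N -> nat)
    (Hb : forall k, 'M[C]_(r k)) (Z : 'I_N -> 'M[C]_n)
    (Y : 'M[C]_(n, \sum_k r k)) :
  let P := @block_proj C N r in let H := \mxdiag_k Hb k in
  let S := delta_op Z P Y in
  H^t* = H -> H \in unitmx ->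
  \tr (Y *m invmx H *m S^t* + S *m invmx H *m Y^t*) =
  \sum_k \tr ((Z k + (Z k)^t*) *m ((Y *m P k) *m invmx H *m (Y *m P k)^t*)).
Proof.
move=> P H S hH Hu.
have PG k : P k *m invmx H = invmx H *m P k.
  by rewrite -[LHS](mulKmx Hu) [H *m _]mulmxA -(block_proj_comm Hb) mulmxK.
have Pid k : P k *m P k = P k by exact: block_proj_id.
have Padj k : (P k)^t* = P k by exact: block_proj_adj.
clearbody P; rewrite /S /delta_op linear_sum /= map_mx_sum /=.
rewrite mulmx_sumr !mulmx_suml -big_split raddf_sum; apply: eq_bigr => k _ /=.
have WE : Y *m P k *m invmx H *m (Y *m P k)^t* = Y *m P k *m invmx H *m Y^t*.
  rewrite adjmxM Padj !mulmxA -[_ *m invmx H *m _]mulmxA -PG mulmxA.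
  by rewrite -[Y *m P k *m P k]mulmxA Pid.
rewrite WE !adjmxM Padj mulmxDl !raddfD /= addrC; congr (_ + _).
  by rewrite !mulmxA.
by rewrite [RHS]mxtrace_mulC !mulmxA -[Y *m invmx H *m _]mulmxA -PG mulmxA.
Qed.

Lemma rational_mxfps_expr (C : fieldType) N q (F : mxfps C N q) :
  rational_mxfps F -> exists e : 'I_q -> 'I_q -> nc_expr C N,
    forall i j, nc_represents (e i j) (mxfps_entry F i j).
Proof.
move=> ratF; have rat i : exists e : 'I_q -> nc_expr C N,
    forall j, nc_represents (e j) (mxfps_entry F i j).
  by have /fin_all_exists [e eF] := ratF i; exists e.
by have /fin_all_exists [e eF] := rat; exists e.
Qed.

(** * From positivity to innerness *)

Section JUnitary.
Context {C : numClosedFieldType} {N q : nat}.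
Variables (J : 'M[C]_q) (F : mxfps C N q) (alpha : gr_node C N q).
Hypotheses (sigJ : signature_mx J) (ratF : rational_mxfps F).
Hypotheses (uniF : matrix_J_unitary J F) (Falpha : gr_realization F alpha).
Local Notation P := (@block_proj C N (gr_dim alpha)).
Local Notation g := (\sum_k gr_dim alpha k)%N.

Lemma constant_term_unitary : gr_D alpha *m J *m (gr_D alpha)^t* = J.
Proof.
have [e eF] := rational_mxfps_expr ratF.
(* The point 0 is skew-Hermitian, and F takes there its constant term D. It is written as the point
   t = 0 of a ray to match [node_value]. *)
pose Z (k : 'I_N) : 'M[C]_1 := 0 *: 0.
have [p [d [Q [[p0 d0] pdef _ _ val]]]] := node_value (fun=> 0 : 'M[C]_1) eF Falpha.
pose M := \sum_i \sum_j (delta_mx i j *t nc_eval Z (e i j)).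
have MV V : row_of V *m M = row_of (V *m gr_D alpha).
  rewrite row_of_value; have [Y [_ ->]] := val 0 V p0 d0.
  by rewrite scale0r mul0mx addr0.
have : M *m (J *t 1%:M) *m M^t* = J *t 1%:M.
  apply: (uniF (Z := Z)); last by exists e; split=> // i j; move: i j; apply/pdef.
  move=> k; exists 0; rewrite /Z ?scaler0 //.
  by apply/hermsymmxP; rewrite trmx0 map_mx0.
move=> MJM; apply/matrixP => i j.
have := row_of_form J (MV (delta_mx 0 i)) (MV (delta_mx 0 j)).
rewrite MJM row_of_tens trmx1 mul1mx row_of_dot adjmxM => /esym.
have rc (X : 'M[C]_q) : \tr (delta_mx 0 i *m X *m (delta_mx 0 j : 'rV_q)^t*) = X i j.
  rewrite trace_mx11 -rowE mxE (bigD1 j) //= big1 => [|l lj].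
    by rewrite !mxE !eqxx addr0 rmorph1 mulr1.
  by rewrite !mxE (negPf lj) andbF rmorph0 mulr0.
by rewrite rc -(rc (_ *m _ *m _)) !mulmxA.
Qed.

Variable H : 'M[C]_g.
Hypothesis assocH : associated_structured_hermitian J H.

Lemma node_energy n (Z : 'I_N -> 'M[C]_n) t (V V' : 'M[C]_(n, q)) Y :
  Y = V *m gr_C alpha + t *: node_op Z Y *m gr_A alpha ->
  V' = V *m gr_D alpha + t *: node_op Z Y *m gr_B alpha ->
  \tr (V *m J *m V^t*) - \tr (V' *m J *m V'^t*) =
  \sum_k \tr (((t *: (Z k)^T) + (t *: (Z k)^T)^t*)
              *m ((Y *m P k) *m invmx H *m (Y *m P k)^t*)).
Proof.
case: assocH => [[Hb HE] /hermsymmxP hH Hu AH BE] YE VE.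
rewrite -raddfB (energy_balance sigJ hH Hu AH BE constant_term_unitary YE VE).
rewrite /node_op -delta_opZ; rewrite HE in hH Hu *.
exact: node_op_balance.
Qed.

Lemma inner_of_posdef : posdefmx H -> matrix_J_inner J F.
Proof.
move=> Hpos; split=> // n Z M Zcl [e [eF edef ->]].
have [_ JJ Jinv] := sigJ.
set M' := \sum_i _; have MV V : row_of V *m M' = row_of (nc_mxval e Z V).
  exact: row_of_value.
split.
  apply/hermsymmxP; rewrite adjmxB !adjmxM trmxCK !mulmxA.
  have -> : (J *t 1%:M)^t* = J *t (1%:M : 'M[C]_n).
    by rewrite trmx_tens map_mxT -JJ trmx1 map_mx1.
  by [].
move=> v; have [V ->] := row_of_surj v.
rewrite mulmxBr mulmxBl mxE [X in _ + X]mxE (row_of_form J (MV V) (MV V)).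
rewrite row_of_tens trmx1 mul1mx row_of_dot.
have [p [d [Q [[p0 d0] pdef _ pQ val]]]] := node_value Z eF Falpha.
have Z1 : (fun k => 1 *: Z k) =1 Z by move=> k; rewrite scale1r.
have p1 : p.[1] != 0.
  by apply/pdef => i j; have [_ ->] := nc_eval_ext (e i j) Z1; exact: edef.
(* For real t, R(t) is |p(t)|^2 times the defect at t Z. Conjugating coefficients instead of values
   keeps R polynomial, so that R(1) can be reached as a limit. *)
pose R := (p * map_poly Num.conj p) * (\tr (V *m J *m V^t*))%:P -
  \tr (Q V *m map_mx polyC J *m (map_mx (map_poly Num.conj) (Q V))^T).
have RE t : t^* = t -> p.[t] != 0 -> R.[t] = `|p.[t]| ^+ 2 *
  (\tr (V *m J *m V^t*) - \tr (nc_mxval e (fun k => t *: Z k) V *m J *m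
                            (nc_mxval e (fun k => t *: Z k) V)^t*)).
  move=> treal pt.
  have conjp (s : {poly C}) : (map_poly Num.conj s).[t] = s.[t]^*.
    by rewrite -{1}treal horner_map.
  rewrite pQ // adjmxZ -scalemxAr -!scalemxAl !linearZ /= mulrBr normCK.
  rewrite hornerD hornerN !hornerM hornerC conjp; congr (_ - _).
  have cpt : p.[t]^* != 0 by rewrite fmorph_eq0.
  rewrite fmorphV -[LHS]/(horner_eval t _) -trace_map_mx !map_mxM.
  have -> : map_mx (horner_eval t) (map_mx polyC J) = J.
    by apply/matrixP => i j; rewrite !mxE /= horner_evalE hornerC.
  have -> : map_mx (horner_eval t) (map_mx (map_poly Num.conj) (Q V))^T =
            (map_mx (horner_eval t) (Q V))^t*.
    by apply/matrixP => i j; rewrite !mxE /= !horner_evalE conjp.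
  by field; rewrite pt cpt.
have R1 : 0 <= R.[1].
  have pd0 : p * d != 0.
    rewrite mulf_neq0 //; apply/eqP => E; [move: p0|move: d0];
    by rewrite E horner0 eqxx.
  apply: (poly_ge0_limit pd0) => t t0 t1.
  rewrite hornerM mulf_eq0 negb_or => /andP[pt dt].
  have treal : t^* = t by apply/CrealP/gtr0_real.
  rewrite RE // mulr_ge0 ?exprn_ge0 //.
  have [Y [YE VE]] := val t V pt dt.
  rewrite (node_energy YE VE); apply: sumr_ge0 => k _.
  rewrite adjmxZ treal adjmx_tr -scalerDr -linearD -scalemxAl linearZ /=.
  rewrite mulr_ge0 ?(ltW t0) //.
  apply: mxtrace_psd_mul_ge0; first exact/psdmx_tr/Zcl.
  move=> x; case: assocH => _ _ Hu _ _.
  have := posdef_invmx_ge0 Hu Hpos (x *m (Y *m P k)).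
  by rewrite adjmxM !mulmxA.
move: R1; rewrite RE ?rmorph1 // (nc_mxval_ext _ _ Z1).
by rewrite pmulr_rge0 // exprn_gt0 ?normr_gt0.
Qed.

End JUnitary.

(** * Observability of minimal nodes *)

Section Observability.
Context {C : fieldType} {N q : nat}.
Variable alpha : gr_node C N q.
Local Notation r := (gr_dim alpha).
Local Notation P := (@block_proj C N (gr_dim alpha)).
Local Notation g := (\sum_k gr_dim alpha k)%N.
Local Notation A := (gr_A alpha).
Local Notation K := (gr_C alpha).

(** The row span of the products C_{j_1} A_{j_1 j_2} ... A_{j_l k} along words of at most m letters
    ending in k: the structured form of the observability matrix. *)
Fixpoint obs_space m k : 'M[C]_(r k) :=
  if m is m'.+1 then
    (submxrow K k + \sum_i <<obs_space m' i *m submxblock A i k>>)%MS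
  else 0.

Lemma obs_spaceS m k : (obs_space m k <= obs_space m.+1 k)%MS.
Proof.
elim: m k => [|m IH] k; first exact: sub0mx.
rewrite [obs_space m.+1 k]/=; apply: addsmxS; first exact: submx_refl.
by apply: sumsmxS => i _; rewrite !genmxE submxMr.
Qed.

(** Until the spaces are stationary the sum of their ranks grows at each step, while it is bounded
    by the dimension of the state space. *)
Lemma obs_space_stationary : exists m, forall k,
  (obs_space m.+1 k <= obs_space m k)%MS.
Proof.
pose s m := (\sum_k \rank (obs_space m k))%N.
pose st m := [forall k, (obs_space m.+1 k <= obs_space m k)%MS].
have grow m : (exists m', st m') \/ (m <= s m)%N.
  elim: m => [|m [IH|IH]]; [by right| by left|].
  have [stm|/forallPn [k nk]] := boolP (st m); first by left; exists m.
  right; apply: leq_ltn_trans IH _; rewrite /s (bigD1 k) //= [ltnRHS](bigD1 k) //=.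
  rewrite -addSn leq_add ?leq_sum // => [|i _]; last exact/mxrankS/obs_spaceS.
  by rewrite (ltn_leqif (mxrank_leqif_sup (obs_spaceS m k))).
have [[m /forallP stm]|] := grow (\sum_k r k).+1; first by exists m.
by rewrite ltnNge /s leq_sum // => k _; exact: rank_leq_col.
Qed.

(** Stationary spaces contain the rows of C and are stable under the blocks of A, so the node can be
    compressed to them. Minimality forbids a drop in dimension. *)
Lemma minimal_observable F : gr_minimal_realization F alpha ->
  exists m, forall k, row_full (obs_space m k).
Proof.
case=> Falpha minalpha; have [m stm] := obs_space_stationary.
exists m; pose O := obs_space m; pose Q k := row_base (O k).
have QO k : (Q k :=: O k)%MS by apply: eq_row_base.
have CQ k : (submxrow K k <= Q k)%MS.
  by rewrite QO (submx_trans _ (stm k)) // addsmxSl.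
have AQ i k : (Q i *m submxblock A i k <= Q k)%MS.
  rewrite QO (submx_trans _ (stm k)) //= (submx_trans _ (addsmxSr _ _)) //.
  by rewrite (sumsmx_sup i) // genmxE submxMr // QO.
(* The node in the coordinates Q k: since C_j and Q_i A_ij lie in the row space of Q_j, the product
   [pinvmx (Q j) *m Q j] acts on them as the identity. *)
pose beta : gr_node C N q := @GRNode C N q (fun k => \rank (O k))
  (\mxblock_(i, j) (Q i *m submxblock A i j *m pinvmx (Q j)))
  (\mxcol_i (Q i *m submxcol (gr_B alpha) i))
  (\mxrow_j (submxrow K j *m pinvmx (Q j))) (gr_D alpha).
have pathE w j : gr_path beta j w = Q j *m gr_path alpha j w.
  elim: w j => [|k w IH] j /=; first by rewrite mxcolK.
  by rewrite IH mxblockK mulmxA mulmxKpV // mulmxA.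
have Fbeta : gr_realization F beta.
  move=> w; rewrite -Falpha; case: w => [|j w] //=.
  by rewrite pathE mxrowK mulmxA mulmxKpV.
move=> k; rewrite /row_full eqn_leq rank_leq_col /=.
exact: (minalpha beta Fbeta k).
Qed.

(* The first clause is the invertibility of [I - Delta(W) A], so that [Y a] is
   the only state driven by [V a] at the common point [W]. *)
Definition reachable k p (X : 'M[C]_(p, r k)) : Prop :=
  exists n (W : 'I_N -> 'M[C]_n) (e : 'rV[C]_n)
    (V : 'I_p -> 'M[C]_(n, q)) (Y : 'I_p -> 'M[C]_(n, g)),
  [/\ forall U, U = delta_op W P U *m A -> U = 0,
      forall a, Y a = V a *m K + delta_op W P (Y a) *m A &
      forall a, submxrow (e *m Y a) k = row a X].

Lemma delta_op_block n1 n2 (W1 : 'I_N -> 'M[C]_n1) (W12 : 'I_N -> 'M[C]_(n1, n2))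
    (W2 : 'I_N -> 'M[C]_n2)
    (Y1 : 'M[C]_(n1, g)) (Y2 : 'M[C]_(n2, g)) :
  delta_op (fun k => block_mx (W1 k) (W12 k) 0 (W2 k)) P
    (col_mx Y1 Y2 : 'M[C]_(n1 + n2, g)) =
  col_mx (delta_op W1 P Y1 + \sum_k W12 k *m Y2 *m P k) (delta_op W2 P Y2).
Proof.
have -> : delta_op W1 P Y1 + \sum_k W12 k *m Y2 *m P k =
    \sum_k (W1 k *m Y1 + W12 k *m Y2) *m P k.
  by rewrite /delta_op -big_split; apply: eq_bigr => k _; rewrite mulmxDl.
rewrite /delta_op.
apply: (big_rec3 (fun y z x : 'M_(_, g) => x = col_mx y z)).
  by rewrite col_mx0.
move=> k y z x _ ->.
by rewrite mul_block_col mul_col_mx mul0mx add0r add_col_mx.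
Qed.

(** The lower half of U solves its own equation and vanishes; the coupling [W12] then disappears
    from the upper one. *)
Lemma block_op_inj n1 n2 (W1 : 'I_N -> 'M[C]_n1) (W12 : 'I_N -> 'M[C]_(n1, n2))
    (W2 : 'I_N -> 'M[C]_n2) :
  (forall U, U = delta_op W1 P U *m A -> U = 0) ->
  (forall U, U = delta_op W2 P U *m A -> U = 0) ->
  forall U, U = delta_op (fun k => block_mx (W1 k) (W12 k) 0 (W2 k)) P U *m A ->
    U = 0.
Proof.
move=> inj1 inj2 U; rewrite -[U]vsubmxK delta_op_block mul_col_mx.
case/eq_col_mx => E1 E2; move/inj2: E2 => E2; move: E1; rewrite E2.
have -> : \sum_k W12 k *m (0 : 'M[C]_(n2, g)) *m P k = 0.
  by apply: big1 => k _; rewrite mulmx0 mul0mx.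
by rewrite addr0 => /inj1 ->; rewrite col_mx0.
Qed.

(** At the point 0 of size 1 the state is just V C. *)
Lemma reachable_output k p (U : 'M[C]_(p, q)) : reachable (U *m submxrow K k).
Proof.
exists 1%N, (fun=> 0), 1%:M, (fun a => row a U), (fun a => row a U *m K).
have op0 (Y : 'M[C]_(1, g)) : delta_op (fun=> 0) P Y = 0.
  by apply: big1 => i _; rewrite !mul0mx.
split=> [Y|a|a]; rewrite ?op0 ?mul0mx ?addr0 // mul1mx.
by rewrite -mul_submxrow row_mul.
Qed.

(** The direct sum of the two points, with the rows e and e' put side by side. *)
Lemma reachableD k p (X X' : 'M[C]_(p, r k)) :
  reachable X -> reachable X' -> reachable (X + X').
Proof.
move=> [n [W [e [V [Y [inj YE XE]]]]]] [n' [W' [e' [V' [Y' [inj' YE' XE']]]]]].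
exists (n + n')%N, (fun j => block_mx (W j) 0 0 (W' j)), (row_mx e e'),
  (fun a => col_mx (V a) (V' a)), (fun a => col_mx (Y a) (Y' a)).
split=> [|a|a]; first exact: (block_op_inj (W12 := fun=> 0)).
  rewrite (delta_op_block W (fun=> 0)).
  have -> : \sum_j (0 : 'M[C]_(n, n')) *m Y' a *m P j = 0.
    by apply: big1 => j _; rewrite !mul0mx.
  by rewrite addr0 !mul_col_mx add_col_mx -YE -YE'.
by rewrite mul_row_col submxrowD XE XE' linearD.
Qed.

(** One more dimension is added, coupled to the old point by the row e in coordinate j only: the new
    row of the state is e Y P_j A, and its k-th block is X A_jk. *)
Lemma reachable_step j k p (X : 'M[C]_(p, r j)) :
  reachable X -> reachable (X *m submxblock A j k).
Proof.
move=> [n [W [e [V [Y [inj YE XE]]]]]].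
pose W12 i := if i == j then e else 0.
have S12 U : \sum_i W12 i *m U *m P i = e *m U *m P j.
  transitivity (W12 j *m U *m P j); last by rewrite /W12 eqxx.
  by apply: big_only1 => // i /negPf ij _; rewrite /W12 ij !mul0mx.
have op0 (U : 'M[C]_(1, g)) : delta_op (fun=> 0) P U = 0.
  by apply: big1 => i _; rewrite !mul0mx.
exists (1 + n)%N, (fun i => block_mx 0 (W12 i) 0 (W i)), (row_mx 1%:M 0),
  (fun a => col_mx 0 (V a)), (fun a => col_mx (e *m Y a *m P j *m A) (Y a)).
split=> [|a|a].
- by apply: (block_op_inj (W1 := fun=> 0)) inj => U; rewrite op0 mul0mx.
- rewrite (delta_op_block (fun=> 0) W12) S12 op0 add0r !mul_col_mx mul0mx.
  by rewrite add_col_mx add0r -YE.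
rewrite mul_row_col mul1mx mul0mx addr0 -mul_submxrow mulmx_block_proj XE.
by rewrite -submxblockEh row_mul.
Qed.

Lemma reachable_obs_space m k p (X : 'M[C]_(p, r k)) :
  (X <= obs_space m k)%MS -> reachable X.
Proof.
have reach0 k' p' : reachable (0 : 'M[C]_(p', r k')).
  by rewrite -[0](mul0mx _ (submxrow K k')); exact: reachable_output.
elim: m k p X => [|m IH] k p X /=; first by rewrite submx0 => /eqP ->.
case/sub_addsmxP => -[U1 U2] /= ->; apply: reachableD.
  exact: reachable_output.
pose S i := obs_space m i *m submxblock A i k.
have /sub_sumsmxP [u ->] : (U2 *m (\sum_i <<S i>>)%MS <= \sum_i <<S i>>)%MS.
  exact: submxMl.
apply: big_ind => [||i _]; [exact: reach0 | exact: reachableD |].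
have /submxP [D ->] : (u i *m <<S i>> <= S i)%MS.
  by rewrite (submx_trans (submxMl _ _)) // genmxE.
by rewrite /S mulmxA; apply/reachable_step/IH/submxMl.
Qed.

End Observability.

(** * From innerness to positivity *)

(** Both invertibility conditions say that a determinant polynomial in s is nonzero. Holding at s =
    1, they hold for all but finitely many s. *)
Lemma generic_compression (C : fieldType) m a (M0 M1 : 'M[C]_m)
    (X : 'M[C]_(a, m)) (L : 'M[C]_(m, a)) :
  M0 + M1 \in unitmx -> X *m invmx (M0 + M1) *m L \in unitmx ->
  exists2 p : {poly C}, p != 0 & forall s, p.[s] != 0 ->
    M0 + s *: M1 \in unitmx /\ X *m invmx (M0 + s *: M1) *m L \in unitmx.
Proof.
pose Mp := map_mx polyC M0 + 'X *: map_mx polyC M1.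
(* The adjugate replaces the inverse to stay polynomial; the two differ by the scalar det (M0 + s
   M1). *)
pose Tp := map_mx polyC X *m \adj Mp *m map_mx polyC L.
have evP b c (M : 'M[C]_(b, c)) s : map_mx (horner_eval s) (map_mx polyC M) = M.
  by apply/matrixP => i j; rewrite !mxE /= horner_evalE hornerC.
have MpE s : map_mx (horner_eval s) Mp = M0 + s *: M1.
  by rewrite map_mxD map_mxZ /= !evP horner_evalE hornerX.
have detMp s : (\det Mp).[s] = \det (M0 + s *: M1) by rewrite -MpE det_map_mx.
have detTp s : M0 + s *: M1 \in unitmx ->
    (\det Tp).[s] = \det (\det (M0 + s *: M1) *: (X *m invmx (M0 + s *: M1) *m L)).
  move=> Mu; have -> : (\det Tp).[s] = \det (map_mx (horner_eval s) Tp).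
    by rewrite det_map_mx.
  rewrite !map_mxM !evP map_mx_adj /= MpE /invmx Mu -scalemxAr -scalemxAl scalerA.
  by rewrite mulfV ?scale1r // -unitfE -unitmxE.
have unitTp s : M0 + s *: M1 \in unitmx ->
    ((\det Tp).[s] != 0) = (X *m invmx (M0 + s *: M1) *m L \in unitmx).
  move=> Mu; rewrite detTp // detZ mulf_eq0 expf_eq0.
  by move: (Mu); rewrite !unitmxE !unitfE => /negPf ->; rewrite andbF.
rewrite -[M1 in M0 + M1]scale1r => Mu Tu; exists (\det Mp * \det Tp).
  apply/eqP => /(congr1 (fun p => p.[1])) /eqP.
  rewrite horner0 hornerM mulf_eq0; apply/negP; rewrite negb_or unitTp // Tu andbT.
  by rewrite detMp -unitfE -unitmxE.
move=> s; rewrite hornerM mulf_eq0 negb_or detMp -unitfE -unitmxE => /andP[Ms].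
by rewrite unitTp.
Qed.

Lemma delta_op_ext (R : comNzRingType) N n g (Z Z' : 'I_N -> 'M[R]_n)
    (P : 'I_N -> 'M[R]_g) Y : Z =1 Z' -> delta_op Z P Y = delta_op Z' P Y.
Proof. by move=> ZZ; apply: eq_bigr => k _; rewrite ZZ. Qed.

Lemma state_mx_ext (R : comNzRingType) N n g (Z Z' : 'I_N -> 'M[R]_n)
    (P : 'I_N -> 'M[R]_g) A : Z =1 Z' -> state_mx Z P A = state_mx Z' P A.
Proof.
by move=> ZZ; apply/matrixP => i j; rewrite !mxE /state_op (delta_op_ext _ _ ZZ).
Qed.

Section Positivity.
Context {C : numClosedFieldType}.

Lemma dot_gt0 n (v : 'rV[C]_n) : v != 0 -> 0 < (v *m v^t*) 0 0.
Proof.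
move=> v0; have vE : (v *m v^t*) 0 0 = \sum_i `|v 0 i| ^+ 2.
  by rewrite mxE; apply: eq_bigr => i _; rewrite !mxE normCK.
rewrite vE lt0r sumr_ge0 ?andbT => [|i _]; last exact: exprn_ge0.
apply: contra v0; rewrite psumr_eq0 => [/allP H|i _]; last exact: exprn_ge0.
apply/eqP/rowP => i; rewrite mxE; apply/eqP.
by have := H i (mem_index_enum i); rewrite expf_eq0 /= normr_eq0.
Qed.

(** The form of H at x is that of its inverse at x H, hence nonnegative. If it vanished at some
    nonzero x, a small move from x along - x H would make it negative. *)
Lemma posdef_of_invmx_ge0 n (H : 'M[C]_n) : H^t* = H -> H \in unitmx ->
  (forall y : 'rV_n, 0 <= (y *m invmx H *m y^t*) 0 0) -> posdefmx H.
Proof.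
move=> hH Hu Gpsd; split; first exact/hermsymmxP.
have Hpsd (x : 'rV_n) : 0 <= (x *m H *m x^t*) 0 0.
  by have := Gpsd (x *m H); rewrite adjmxM hH mulmxK // mulmxA.
move=> x x0; rewrite lt0r Hpsd andbT; apply/negP => /eqP q0.
pose w := x *m H; have w0 : w != 0.
  by apply: contra x0 => /eqP w0; rewrite -[x](mulmxK Hu) -/w w0 mul0mx.
pose a := (w *m w^t*) 0 0; have a0 : 0 < a by apply: dot_gt0.
pose b := (w *m H *m w^t*) 0 0; have b0 : 0 <= b by apply: Hpsd.
have b1 : 0 < b + 1 by rewrite ltr_wpDl.
(* the quadratic form at [x - c w], with [c] real, equals [c ^ 2 b - 2 c a] *)
pose c := a / (b + 1); have c0 : 0 < c by rewrite divr_gt0.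
have creal : c^* = c by apply/CrealP/gtr0_real.
have := Hpsd (x - c *: w).
have -> : ((x - c *: w) *m H *m (x - c *: w)^t*) 0 0 = c * (c * b - 2%:R * a).
  have aE : (w *m H *m x^t*) 0 0 = a by rewrite -mulmxA -{1}hH -adjmxM.
  have aE' : (x *m H *m w^t*) 0 0 = a by [].
  rewrite adjmxB adjmxZ creal !mulmxBl !mulmxBr -!scalemxAl -!scalemxAr.
  move: q0 aE aE'; rewrite /b; move: (x *m H *m x^t*) (w *m H *m x^t*).
  move: (x *m H *m w^t*) (w *m H *m w^t*) => m1 m2 m3 m4 e1 e2 e3.
  by rewrite !mxE e1 e2 e3; ring.
rewrite pmulr_rge0 // subr_ge0 => le2a.
have lea : c * b <= a.
  by rewrite /c mulrAC ler_pdivrMr // ler_wpM2l ?lerDl // ltW.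
by have := le_trans le2a lea; rewrite mulr_natl mulr2n gerDl lt_geF.
Qed.

End Positivity.

Section Selection.
Context {C : fieldType} {n N : nat} {r : 'I_N -> nat}.
Notation g := (\sum_k r k)%N.
Variables (e : 'rV[C]_n) (k : 'I_N).

Definition select (y : 'rV[C]_(n * g)) : 'rV[C]_(r k) :=
  submxrow (e *m vec_mx y) k.

Fact select_is_linear : linear select.
Proof.
move=> a x y; rewrite /select linearP mulmxDr -scalemxAr submxrowD.
by congr (_ + _); apply/matrixP => i j; rewrite !mxE.
Qed.
HB.instance Definition _ :=
  GRing.isLinear.Build C _ _ _ select select_is_linear.

End Selection.

Section Innerness.
Context {C : numClosedFieldType} {N q : nat}.
Variables (J : 'M[C]_q) (F : mxfps C N q) (alpha : gr_node C N q).
Hypotheses (sigJ : signature_mx J) (ratF : rational_mxfps F).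
Hypotheses (innF : matrix_J_inner J F) (Falpha : gr_realization F alpha).
Local Notation r := (gr_dim alpha).
Local Notation P := (@block_proj C N r).
Local Notation g := (\sum_k r k)%N.
Local Notation A := (gr_A alpha).
Local Notation K := (gr_C alpha).
Variable H : 'M[C]_g.
Hypothesis assocH : associated_structured_hermitian J H.

(* For matrices [Zt] on the boundary whose real parts vanish except that of
   [Zt k], which is of rank one, the defect of J-unitarity of the value of F
   is a multiple of the form defined by the k-th block of the inverse of H. *)
Lemma reachable_block_ge0 k :
  reachable (alpha := alpha) (k := k) 1%:M ->
  forall x : 'rV[C]_(r k),
    0 <= (x *m submxcol 1%:M k *m invmx H *m (x *m submxcol 1%:M k)^t*) 0 0.
Proof.
move=> [n [W [e [V [Y [inj YE YX]]]]]].
pose E := e^t* *m e; have hE : E^t* = E by rewrite adjmxM trmxCK.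
(* [Z0] keeps the prescribed real part and the skew-Hermitian part of G, and [Z1] is the Hermitian
   part of G. Thus Z0 + s Z1 is W at s = 1, and for s imaginary its real part is E in coordinate k
   and 0 elsewhere. *)
pose G j := W j - (j == k)%:R *: E.
pose Z0 j := (j == k)%:R *: E + 2%:R^-1 *: (G j - (G j)^t*).
pose Z1 j := 2%:R^-1 *: (G j + (G j)^t*).
(* X lists the inputs V a C, and L reads the k-th block of e Y. Hence X (M0 + s M1)^-1 L is the map
   from inputs to selected blocks; at s = 1 it is the identity. *)
pose X := \matrix_a mxvec (V a *m K); pose L := lin1_mx (@select C n N r e k).
pose M0 := 1%:M - state_mx Z0 P A; pose M1 := - state_mx Z1 P A.
have ZW j : Z0 j + Z1 j = W j.
  by apply/matrixP => a b; rewrite !mxE; field.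
have ME s : M0 + s *: M1 = 1%:M - state_mx (fun j => Z0 j + s *: Z1 j) P A.
  by rewrite state_mxD state_mxZ opprD addrA scalerN.
have M01 : M0 + M1 = 1%:M - state_mx W P A.
  rewrite -[M1]scale1r ME (state_mx_ext (Z' := W)) // => b.
  by rewrite scale1r ZW.
have Mu : M0 + M1 \in unitmx.
  rewrite -row_free_unit -kermx_eq0; apply/rowV0P => v /sub_kermxP.
  rewrite M01 -[v]vec_mxK mulmxBr mulmx1 mul_mxvec_state_mx -linearB /=.
  move/(congr1 vec_mx); rewrite mxvecK linear0 => /eqP.
  by rewrite subr_eq0 => /eqP/inj ->; rewrite linear0.
have XL : X *m invmx (M0 + M1) *m L = 1%:M.
  apply/row_matrixP => a; rewrite -YX !row_mul rowK.
  have -> : mxvec (V a *m K) = mxvec (Y a) *m (M0 + M1).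
    by rewrite M01 mulmxBr mulmx1 mul_mxvec_state_mx -linearB {1}YE addrK.
  by rewrite mulmxK // mul_rV_lin1 /= /select mxvecK.
have [|p1 p1n0 p1P] := generic_compression (L := L) (X := X) Mu.
  by rewrite XL unitmx1.
have [|m pi] := generic_point p1n0 (s := fun m => 'i * m%:R).
  by move=> i1 i2 /(mulfI (neq0Ci _))/eqP; rewrite eqr_nat => /eqP.
set s := 'i * _ in pi; have sconj : s^* = - s.
  by rewrite /s rmorphM /= conjCi rmorph_nat mulNr.
clearbody G; pose Zt j := Z0 j + s *: Z1 j.
have ZtE j : Zt j + (Zt j)^t* = (2%:R * (j == k)%:R) *: E.
  rewrite /Zt /Z0 /Z1 !(adjmxD, adjmxZ, adjmxN) !trmxCK sconj hE.
  rewrite rmorph_nat fmorphV rmorph_nat.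
  by move: (E) => E0; apply/matrixP => i1 i2; rewrite !mxE; field.
have [Mu' Tu'] := p1P _ pi.
have Ms t : 1%:M + t *: (M0 + s *: M1 - 1%:M) = 1%:M - t *: state_mx Zt P A.
  by rewrite ME addrAC subrr add0r scalerN.
have addK1 : 1%:M + (M0 + s *: M1 - 1%:M) = M0 + s *: M1 by rewrite addrC subrK.
(* The expressions for F may be undefined at the point itself, but they are defined at t Z for
   generic t. Invertibility, known at t = 1, is generic too, and any t > 0 preserves the closed
   half-plane. *)
have [||p2 p2n0 p2P] := generic_compression (M0 := 1%:M)
    (M1 := M0 + s *: M1 - 1%:M) (L := L) (X := X); rewrite ?addK1 //.
have [ex exF] := rational_mxfps_expr ratF.
pose Z j := (Zt j)^T.
have [p [d [Q [[p0 d0] pdef dE _ val]]]] := node_value Z exF Falpha.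
have pp0 : p2 * p != 0.
  by rewrite mulf_neq0 //; apply/eqP => E0; move: p0; rewrite E0 horner0 eqxx.
have [|l] := generic_point pp0 (s := fun m => m.+1%:R).
  by move=> m1 m2 /eqP; rewrite eqr_nat => /eqP[].
set t := _%:R; rewrite hornerM mulf_eq0 negb_or => /andP[/p2P [] + + pt].
have t0 : 0 < t by rewrite ltr0n.
have treal : t^* = t by apply/CrealP/gtr0_real.
rewrite Ms; set Mt := 1%:M - _ => Mtu Ttu.
have Zt_state : node_mx alpha Z = state_mx Zt P A.
  by apply: state_mx_ext => j; rewrite trmxK.
have dt : d.[t] != 0 by rewrite dE Zt_state -unitfE -unitmxE.
(* The combination of the inputs V a whose state has selected block x. *)
move=> x; pose c := x *m invmx (X *m invmx Mt *m L).
pose V0 := \sum_a c 0 a *: V a.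
have V0E : mxvec (V0 *m K) = c *m X.
  rewrite mulmx_suml linear_sum mulmx_sum_row; apply: eq_bigr => a _.
  by rewrite -scalemxAl linearZ rowK.
have [Y0 [Y0E V0F]] := val t V0 pt dt.
have Y0x : submxrow (e *m Y0) k = x.
  have : mxvec Y0 *m Mt = c *m X.
    rewrite -V0E /Mt -Zt_state mulmxBr mulmx1 -scalemxAr mul_mxvec_state_mx.
    by rewrite -linearZ -linearB {1}Y0E scalemxAl addrK.
  move/(congr1 (fun y => y *m invmx Mt *m L)).
  rewrite mulmxK // mul_rV_lin1 /= /select mxvecK => ->.
  by rewrite -[c *m X *m _]mulmxA -[c *m _ *m L]mulmxA mulmxKV.
have [_ psdF] := innF.
pose M := \sum_i \sum_j (delta_mx i j *t nc_eval (fun j => t *: Z j) (ex i j)).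
have MV : row_of V0 *m M = row_of (nc_mxval ex (fun j => t *: Z j) V0).
  exact: row_of_value.
have [||_ /(_ (row_of V0))] := psdF n (fun j => t *: Z j) M.
- move=> j; have -> : t *: Z j + (t *: Z j)^t* = (t *: (Zt j + (Zt j)^t*))^T.
    by rewrite adjmxZ treal adjmx_tr -scalerDr -linearD linearZ.
  apply: psdmx_tr; rewrite ZtE scalerA; split.
    by apply/hermsymmxP; rewrite adjmxZ hE !rmorphM /= !rmorph_nat.
  move=> v; rewrite -scalemxAr -scalemxAl mxE mulr_ge0 ?mulr_ge0 ?ler0n //.
  have -> : v *m E *m v^t* = (v *m e^t*) *m (v *m e^t*)^t*.
    by rewrite adjmxM trmxCK !mulmxA.
  have [->|/dot_gt0/ltW//] := eqVneq (v *m e^t*) 0.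
  by rewrite mul0mx mxE.
- by exists ex; split=> //; apply/pdef.
rewrite mulmxBr mulmxBl mxE [X in _ + X]mxE (row_of_form J MV MV).
rewrite row_of_tens trmx1 mul1mx row_of_dot.
rewrite (node_energy sigJ ratF innF.1 Falpha assocH Y0E V0F).
have eYP : e *m (Y0 *m P k) = x *m submxcol 1%:M k.
  by rewrite /block_proj !mulmxA mul_submxrow mulmx1 Y0x.
have ZE j : t *: (Z j)^T + (t *: (Z j)^T)^t* = (t * (2%:R * (j == k)%:R)) *: E.
  by rewrite trmxK adjmxZ treal -scalerDr ZtE scalerA.
(* Only the k-th summand survives, and as E = e^* e its trace is the form of the inverse of H at e
   Y0 P k. *)
rewrite [X in 0 <= X](_ : _ = t * 2%:R * (x *m submxcol 1%:M k *m invmx H *m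
    (x *m submxcol 1%:M k)^t*) 0 0).
  by rewrite pmulr_rge0 // mulr_gt0 ?ltr0n.
transitivity (\tr ((t *: (Z k)^T + (t *: (Z k)^T)^t*) *m
    (Y0 *m P k *m invmx H *m (Y0 *m P k)^t*))).
  apply: big_only1 => // j /negPf jk _.
  by rewrite ZE jk !mulr0 scale0r mul0mx mxtrace0.
rewrite ZE eqxx mulr1 -scalemxAl mxtraceZ -eYP -trace_mx11; congr (_ * _).
by rewrite /E -mulmxA mxtrace_mulC [(e *m _)^t*]adjmxM !mulmxA.
Qed.

(** Full observability makes the identity matrix reachable for every k, so each diagonal block of
    the inverse of H is nonnegative. *)
Lemma posdef_of_inner m :
  (forall k, row_full (obs_space alpha m k)) -> posdefmx H.
Proof.
move=> full; have [[Hb HE] /hermsymmxP hH Hu _ _] := assocH.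
apply: posdef_of_invmx_ge0 => // y; rewrite -trace_mx11.
(* With all Z k equal to 1/2 the real parts are 1 and S = y / 2: the balance identity becomes the
   splitting of the form of the inverse of H into its blocks. *)
have half_op : delta_op (fun=> 2%:R^-1%:M) P y = 2%:R^-1 *: y.
  rewrite -[RHS]mulmx1 -sum_block_proj mulmx_sumr; apply: eq_bigr => k _.
  by rewrite mul_scalar_mx.
have := node_op_balance (fun=> 2%:R^-1%:M) y (Hb := Hb); rewrite /= -HE half_op.
move/(_ hH Hu).
have -> : y *m invmx H *m (2%:R^-1 *: y)^t* + 2%:R^-1 *: y *m invmx H *m y^t*
          = y *m invmx H *m y^t*.
  rewrite adjmxZ fmorphV rmorph_nat -!scalemxAr -!scalemxAl -scalerDl.
  by rewrite -[RHS]scale1r; congr (_ *: _); field.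
move=> ->; apply: sumr_ge0 => k _.
have -> : (2%:R^-1%:M + (2%:R^-1%:M)^t*) = 1%:M :> 'M[C]_1.
  apply/matrixP => i j; rewrite !ord1 !mxE eqxx !mulr1n fmorphV rmorph_nat.
  by field.
rewrite mul1mx trace_mx11 /block_proj !mulmxA mul_submxrow mulmx1.
apply: reachable_block_ge0; apply: (@reachable_obs_space _ _ _ _ m).
by rewrite submx_full.
Qed.

End Innerness.

Theorem theorem6p1 (R : realType) (N q : nat) (J : 'M[R[i]]_q)
    (F : mxfps R[i] N q) (alpha : gr_node R[i] N q)
    (H : 'M[R[i]]_(\sum_k gr_dim alpha k)) :
  signature_mx J ->
  rational_mxfps F ->
  matrix_J_unitary J F ->
  gr_minimal_realization F alpha ->
  associated_structured_hermitian J H ->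
  (matrix_J_inner J F <-> posdefmx H).
Proof.
move=> sigJ ratF uniF minF assocH; split=> [innF|].
  have [m full] := minimal_observable minF.
  exact: (posdef_of_inner sigJ ratF innF minF.1 assocH full).
exact: (inner_of_posdef sigJ ratF uniF minF.1 assocH).
Qed.
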